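(* Let $M$ be an $m\times n$ ACI-matrix over a field $\mathbb{F}$ with $|\mathbb{F}|\geq\max\{m,n+1\}$. Then $M$ is constantRank if and only if there exist a nonsingular constant matrix $R$ and a permutation matrix $Q$ such that $$RMQ=\begin{bmatrix} \mathbf{W} & * & *\\ 0 & \mathbf{S} & *\\ 0 & 0 & \mathbf{T}\end{bmatrix}$$ where: $\mathbf{W}=\begin{bmatrix} U_1 & *\end{bmatrix}$ is wide with $U_1$ a square upper unitriangular block (ones on the diagonal, zeros below it, arbitrary entries above it), or $\mathbf{W}$ is wide degenerate or void; $\mathbf{S}$ is a square upper unitriangular block or void; and $\mathbf{T}=\begin{bmatrix} * \\ U_3\end{bmatrix}$ is tall with $U_3$ a square upper unitriangular block, or $\mathbf{T}$ is tall degenerate or void (here $*$ denotes arbitrary blocks of appropriate sizes with ACI entries). Moreover, if $\mathbf{S}$ is required to be as large as possible, then the three blocks $\mathbf{W}$, $\mathbf{S}$, $\mathbf{T}$ are unique up to equivalence.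
   Context: An ACI-matrix over a field $\mathbb{F}$ is a matrix with entries in $\mathbb{F}[x_1,\dots,x_k]$ whose entries are polynomials of degree at most one and such that no indeterminate appears in two different columns. A completion is an assignment of values in $\mathbb{F}$ to all indeterminates, producing a constant matrix; $\mathrm{maxRank}(M)$ and $\mathrm{minRank}(M)$ are the maximum and minimum ranks of completions, and $M$ is constantRank if $\mathrm{maxRank}(M)=\mathrm{minRank}(M)$. Two ACI-matrices are equivalent, $N\sim N'$, if $N'=RNQ$ with $R$ nonsingular constant and $Q$ a permutation matrix. Wide/tall/square: more columns than rows / more rows than columns / equal. ACI-matrices of size $0\times q$ ($q>0$, wide degenerate), $p\times 0$ ($p>0$, tall degenerate) and $0\times 0$ (void) are allowed as blocks. *)

(* Defs.v *)
From HB Require Import structures.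
From mathcomp Require Import all_boot all_order all_algebra all_fingroup.
From mathcomp Require Import mpoly.
Set Implicit Arguments.
Unset Strict Implicit.
Unset Printing Implicit Defensive.
Import GRing.Theory.
Local Open Scope ring_scope.

Section ACI.
Variables (F : fieldType) (k : nat).

Local Notation P := {mpoly F[k]}.

Definition occurs (l : 'I_k) (p : P) : Prop :=
  exists2 mon : 'X_{1..k}, mon \in msupp p & (0 < mon l)%N.

Definition is_ACI (m n : nat) (M : 'M[P]_(m, n)) : Prop :=
  (forall i j, (msize (M i j) <= 2)%N) /\
  (forall (l : 'I_k) (i1 i2 : 'I_m) (j1 j2 : 'I_n),
      occurs l (M i1 j1) -> occurs l (M i2 j2) -> j1 = j2).

Definition completion (m n : nat) (M : 'M[P]_(m, n)) (v : 'I_k -> F)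
  : 'M[F]_(m, n) := map_mx (meval v) M.

Definition is_maxRank (m n : nat) (M : 'M[P]_(m, n)) (r : nat) : Prop :=
  (exists v, \rank (completion M v) = r) /\
  (forall v, (\rank (completion M v) <= r)%N).

Definition is_minRank (m n : nat) (M : 'M[P]_(m, n)) (r : nat) : Prop :=
  (exists v, \rank (completion M v) = r) /\
  (forall v, (r <= \rank (completion M v))%N).

Definition constantRank (m n : nat) (M : 'M[P]_(m, n)) : Prop :=
  exists r, is_maxRank M r /\ is_minRank M r.

Definition cst_mx (m n : nat) (A : 'M[F]_(m, n)) : 'M[P]_(m, n) :=
  map_mx (fun c => c%:MP) A.

Definition aci_equiv (m n : nat) (N N' : 'M[P]_(m, n)) : Prop :=
  exists (R : 'M[F]_m) (Q : 'M[F]_n),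
    R \in unitmx /\ is_perm_mx Q /\ N' = cst_mx R *m N *m cst_mx Q.

Definition aci_equivT (m n m' n' : nat) (N : 'M[P]_(m, n)) (N' : 'M[P]_(m', n'))
  : Prop :=
  exists (Em : m = m') (En : n = n'), aci_equiv (castmx (Em, En) N) N'.

Definition unitri (p : nat) (S : 'M[P]_p) : Prop :=
  forall i j : 'I_p, (j <= i)%N -> S i j = (i == j :> nat)%:R.

(* W = [U1 *] wide with U1 upper unitriangular, or wide degenerate, or void *)
Definition W_block (p q : nat) (W : 'M[P]_(p, q)) : Prop :=
  ((p < q)%N \/ (p = 0%N /\ q = 0%N)) /\
  (forall (i : 'I_p) (j : 'I_q), (j <= i)%N -> W i j = (i == j :> nat)%:R).

(* T = [*; U3] tall with U3 (the bottom q x q block) upper unitriangular,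
   or tall degenerate, or void *)
Definition T_block (p q : nat) (T : 'M[P]_(p, q)) : Prop :=
  ((q < p)%N \/ (p = 0%N /\ q = 0%N)) /\
  (forall (i : 'I_p) (j : 'I_q), (p - q + j <= i)%N ->
      T i j = (i == (p - q + j)%N :> nat)%:R).

Definition stair_form (m n : nat) (N : 'M[P]_(m, n))
  (m1 m2 m3 n1 n3 : nat) (W : 'M[P]_(m1, n1)) (S : 'M[P]_m2)
  (T : 'M[P]_(m3, n3)) : Prop :=
  W_block W /\ unitri S /\ T_block T /\
  exists (Em : (m1 + (m2 + m3))%N = m) (En : (n1 + (m2 + n3))%N = n)
         (X : 'M[P]_(m1, m2)) (Y : 'M[P]_(m1, n3)) (Z : 'M[P]_(m2, n3)),
    N = castmx (Em, En)
          (block_mx W (row_mx X Y) 0 (block_mx S Z 0 T)).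

Definition has_decomp (m n : nat) (M : 'M[P]_(m, n))
  (m1 m2 m3 n1 n3 : nat) (W : 'M[P]_(m1, n1)) (S : 'M[P]_m2)
  (T : 'M[P]_(m3, n3)) : Prop :=
  exists (R : 'M[F]_m) (Q : 'M[F]_n),
    R \in unitmx /\ is_perm_mx Q /\
    stair_form (cst_mx R *m M *m cst_mx Q) W S T.

Definition has_max_decomp (m n : nat) (M : 'M[P]_(m, n))
  (m1 m2 m3 n1 n3 : nat) (W : 'M[P]_(m1, n1)) (S : 'M[P]_m2)
  (T : 'M[P]_(m3, n3)) : Prop :=
  has_decomp M W S T /\
  forall (m1' m2' m3' n1' n3' : nat) (W' : 'M[P]_(m1', n1')) (S' : 'M[P]_m2')
         (T' : 'M[P]_(m3', n3')),
    has_decomp M W' S' T' -> (m2' <= m2)%N.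

End ACI.

(* Main.v *)
Require Import Defs.
From HB Require Import structures.
From mathcomp Require Import all_boot all_order all_algebra all_fingroup.
From mathcomp Require Import mpoly zify.

(* The columns of an ACI-matrix range independently over affine subspaces of
   F^m.  Writing rho(J) for the rank of the span of all values of the columns in
   J, every completion has rank at most rho(J) + #|~: J|, and Rado's theorem on
   independent transversals provides a J for which this bound is the maximal
   rank; such a J is called tight.  When the rank is constant, a chain J1 <= J2
   of tight sets puts M in block upper triangular form with diagonal blocks of
   constant full row rank, nonsingular, and of constant full column rank.
   A constant full row rank matrix has a constant nonzero column, since
   otherwise some nonzero functional can be made to vanish on all columns; a
   constant full column rank matrix has a column on which a functional killing
   all the other columns takes the constant value 1, since otherwise some
   linear combination of the columns with nonzero coefficients can be made to
   vanish.  Both steps avoid finitely many hyperplanes, which is where the size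
   of F enters, and recursion gives the unitriangular blocks.
   Tight sets are closed under union and intersection, because rho is
   submodular, so decompositions with S as large as possible all come from the
   same pair J1, J2, and the blocks are then determined up to equivalence. *)

Set Implicit Arguments.
Unset Strict Implicit.
Unset Printing Implicit Defensive.
Import GRing.Theory.
Local Open Scope ring_scope.

(** * Linear algebra *)

Section LinearAlgebra.
Variable F : fieldType.

(** Columns are treated one at a time. When the current [y] kills column [t], it is replaced by
    [z + c *: y] for some [z] not killing that column. Since [y] is scaled and not [z], column [t]
    survives for every [c], so only the [t < q] earlier columns exclude one value of [c] each, and
    [q] scalars suffice. *)
Lemma exists_nowhere_zero_combination (s : seq F) (a q : nat) (A : 'M[F]_(a, q)) :
  uniq s -> (q <= size s)%N -> (forall j, col j A != 0) ->
  exists y : 'rV_a, forall j, (y *m A) 0 j != 0.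
Proof.
move=> us qs Anz.
suff H t : (t <= q)%N ->
    exists y : 'rV_a, forall j : 'I_q, (j < t)%N -> (y *m A) 0 j != 0.
  by have [y yP] := H q (leqnn q); exists y => j; apply: yP.
elim: t => [|t IHt] ltq; first by exists 0.
have [y yP] := IHt (ltnW ltq); pose jt := Ordinal ltq.
have [y0|yn0] := eqVneq ((y *m A) 0 jt) 0; last first.
  exists y => j; rewrite ltnS leq_eqVlt => /predU1P[jE|/yP//].
  by rewrite (_ : j = jt) //; apply: val_inj.
have [i Ai] : exists i, A i jt != 0.
  have /cV0Pn[i] := Anz jt; rewrite mxE => Ai.
  by exists i.
pose z : 'rV[F]_a := delta_mx 0 i.
have zE j : (z *m A) 0 j = A i j by rewrite -rowE mxE.
pose bad := [seq - A i j / (y *m A) 0 j | j : 'I_q <- enum 'I_q & (j < t)%N].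
have [c cs cbad] : exists2 c, c \in s & c \notin bad.
  apply/hasP; rewrite -[has _ _]negbK -all_predC; apply/negP => /allP sb.
  have /(uniq_leq_size us) : {subset s <= bad} by move=> c /sb /=; rewrite negbK.
  rewrite size_map -(size_map (@nat_of_ord q)) => sz.
  have : (size [seq nat_of_ord j | j : 'I_q <- enum 'I_q & (j < t)%N] <= t)%N.
    rewrite -[leqRHS](size_iota 0); apply: uniq_leq_size.
      by rewrite (map_inj_uniq val_inj) filter_uniq ?enum_uniq.
    by move=> x /mapP[j]; rewrite mem_filter mem_iota => /andP[jt' _] ->.
  by move=> sz2; have := leq_trans (leq_trans qs sz) sz2; rewrite leqNgt ltq.
exists (z + c *: y) => j; rewrite ltnS leq_eqVlt mulmxDl -scalemxAl.
have E : (z *m A + c *: (y *m A)) 0 j = A i j + c * (y *m A) 0 j.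
  by rewrite mxE zE mxE.
rewrite E; case/predU1P=> [jE|jlt].
  by rewrite (_ : j = jt) ?y0 ?mulr0 ?addr0 //; apply: val_inj.
apply: contraNneq cbad => e0; apply/mapP; exists j.
  by rewrite mem_filter jlt mem_enum.
move/eqP: e0; rewrite addrC addr_eq0 => /eqP <-.
by rewrite mulfK ?yP.
Qed.

(** In the factorisation [B = L *m pid_mx r *m E] with r the rank of [B], the hypothesis says, on
    unfolding [kermx], that [invmx L *m X] is supported on its first r rows. The system can then be
    solved through [E]. *)
Lemma mulmx_solvable (p q t : nat) (B : 'M[F]_(p, q)) (X : 'M[F]_(p, t)) :
  kermx B *m X = 0 -> exists Y, X = B *m Y.
Proof.
move=> KX; pose L := col_ebase B; pose E := row_ebase B.
have LX : invmx L *m X = pid_mx (\rank B) *m (invmx L *m X).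
  apply/eqP; rewrite -subr_eq0 -{1}[invmx L *m X]mul1mx -mulmxBl.
  by rewrite mulmxA; apply/eqP.
exists (invmx E *m pid_mx (\rank B) *m (invmx L *m X)).
rewrite -{1}(mulmx_ebase B) -/L -/E.
rewrite -{1}[X](mulKVmx (col_ebase_unit B)) -/L {1}LX.
rewrite !mulmxA mulmxK ?row_ebase_unit //.
rewrite -[L *m _ *m pid_mx _]mulmxA.
by rewrite pid_mx_id ?rank_leq_col.
Qed.

Lemma mxrank_ublock_le (p1 p2 q1 q2 : nat) (B : 'M[F]_(p1, q1))
    (C : 'M[F]_(p1, q2)) (D : 'M[F]_(p2, q2)) :
  (\rank (block_mx B C 0 D) <= \rank B + q2)%N /\
  (\rank (block_mx B C 0 D) <= p1 + \rank D)%N.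
Proof.
split.
  rewrite -mxrank_tr tr_block_mx trmx0 block_mxEv -addsmxE.
  rewrite (leq_trans (mxrank_adds_leqif _ _).1) //.
  by rewrite rank_row_mx0 mxrank_tr leq_add2l rank_leq_row.
rewrite block_mxEv -addsmxE (leq_trans (mxrank_adds_leqif _ _).1) //.
by rewrite rank_row_0mx leq_add2r rank_leq_row.
Qed.

(** A right inverse of [B] clears [C] by column operations. *)
Lemma mxrank_ublock_row_free (p1 p2 q1 q2 : nat) (B : 'M[F]_(p1, q1))
    (C : 'M[F]_(p1, q2)) (D : 'M[F]_(p2, q2)) :
  row_free B -> \rank (block_mx B C 0 D) = (p1 + \rank D)%N.
Proof.
move=> Bfree; have /row_freeP[B' BB'] := Bfree.
have E : block_mx B C 0 D *m block_mx 1%:M (- (B' *m C)) 0 1%:M =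
    block_mx B 0 0 D.
  rewrite mulmx_block !mulmx1 !mulmx0 !mul0mx !addr0 !add0r.
  by rewrite mulmxN mulmxA BB' mul1mx addNr.
rewrite -(mxrankMfree (block_mx B C 0 D) (B := block_mx 1%:M (- (B' *m C)) 0 1%:M)).
  by rewrite E rank_diag_block_mx; congr addn; apply/eqP.
by rewrite row_free_unit unitmxE det_ublock !det1 mulr1 unitr1.
Qed.

Lemma upper_unitriangular_unit (p : nat) (U : 'M[F]_p) :
  (forall i j : 'I_p, (j <= i)%N -> U i j = (i == j :> nat)%:R) -> U \in unitmx.
Proof.
move=> UE; rewrite -unitmx_tr unitmxE det_trig.
  by rewrite big1 ?unitr1 // => i _; rewrite mxE UE ?eqxx.
apply/is_trig_mxP => i j lt_ij; rewrite mxE UE ?(ltnW lt_ij) //.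
by rewrite gtn_eqF.
Qed.

Lemma mxrank_rowsub_le (p p' q : nat) (f : 'I_p' -> 'I_p) (A : 'M[F]_(p, q)) :
  (\rank (rowsub f A) <= \rank A)%N.
Proof. by rewrite rowsubE mxrankM_maxr. Qed.

Lemma mxrank_colsub_le (p q q' : nat) (f : 'I_q' -> 'I_q) (A : 'M[F]_(p, q)) :
  (\rank (colsub f A) <= \rank A)%N.
Proof.
by rewrite -mxrank_tr -[leqRHS]mxrank_tr trmx_mxsub mxrank_rowsub_le.
Qed.
End LinearAlgebra.

(** * Rado's theorem *)

Section Rado.
Variables (F : fieldType) (m n : nat) (O : finType) (x : 'I_n -> O -> 'rV[F]_m).

(** The sets [D j] of admissible points are a parameter because the proof of Rado's theorem deletes
    points one by one. *)
Definition point_span (D : 'I_n -> {set O}) (J : {set 'I_n}) : 'M[F]_m :=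
  (\sum_(j in J) \sum_(o in D j) <<x j o>>)%MS.

Lemma sub_point_span (D : 'I_n -> {set O}) (J : {set 'I_n}) j o :
  j \in J -> o \in D j -> (x j o <= point_span D J)%MS.
Proof.
move=> jJ oD; apply: (sumsmx_sup j) => //; apply: (sumsmx_sup o) => //.
by rewrite genmxE.
Qed.

Lemma point_span_subP (D : 'I_n -> {set O}) (J : {set 'I_n}) p (B : 'M_(p, m)) :
  (forall j o, j \in J -> o \in D j -> (x j o <= B)%MS) ->
  (point_span D J <= B)%MS.
Proof.
move=> sB; apply/sumsmx_subP => j jJ; apply/sumsmx_subP => o oD.
by rewrite genmxE sB.
Qed.

(** Induction on the total number of admissible points. If some [D j] has two points, one of them
    can be deleted without breaking the rank condition. If every [D j] is a singleton, the condition
    for the set of all indices is the conclusion. *)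
Lemma rado_transversal (D : 'I_n -> {set O}) (r : nat) :
  (forall j, D j != set0) ->
  (forall J, r <= \rank (point_span D J) + #|~: J|)%N ->
  exists g : 'I_n -> O, (r <= \rank (\matrix_j x j (g j)))%N.
Proof.
move: {2}(\sum_j #|D j|)%N (leqnn (\sum_j #|D j|)) => N.
elim: N D => [|N IHN] D leN Dn0 hD; last first.
  have [/existsP[j Dj]|D1] := boolP [exists j, 1 < #|D j|]%N.
    have [o1 [o2 [o1D o2D o12]]] := card_gt1P Dj.
    pose D' o i := if i == j then D j :\ o else D i.
    have D'n0 o' o : o' \in D j -> o' != o -> forall i, D' o i != set0.
      move=> o'D oo' i; rewrite /D'; case: (i =P j) => _ //.
      by apply/set0Pn; exists o'; rewrite !inE oo'.
    have D'N o : o \in D j -> (\sum_i #|D' o i| <= N)%N.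
      move=> oD; rewrite -ltnS (leq_trans _ leN) // (bigD1 j) //= [ltnRHS](bigD1 j) //=.
      rewrite {1}/D' eqxx (cardsD1 o (D j)) oD (eq_bigr (fun i => #|D i|)).
        by rewrite add1n addSn.
      by move=> i /negPf ij; rewrite /D' ij.
    (* A set that violates the condition after the deletion contains [j], since otherwise its points
       are unchanged. *)
    have small o : (forall J, r <= \rank (point_span (D' o) J) + #|~: J|)%N \/
        exists2 J : {set 'I_n}, j \in J & (\rank (point_span (D' o) J) + #|~: J| < r)%N.
      have [/forallP|/forallPn[J]] :=
        boolP [forall J : {set 'I_n}, r <= \rank (point_span (D' o) J) + #|~: J|]%N;
        first by left.
      rewrite -ltnNge => Jr; right; exists J => //; apply: contraLR Jr => jJ.
      rewrite -leqNgt (leq_trans (hD J)) // leq_add2r mxrankS //.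
      apply: point_span_subP => i o' iJ o'D; apply: sub_point_span => //.
      by rewrite /D'; case: (i =P j) => // ij; rewrite -ij iJ in jJ.
    have [h1|[J1 j1 r1]] := small o1.
      by apply: (IHN (D' o1)) => //; [exact: D'N | apply: (D'n0 o2); rewrite // eq_sym].
    have [h2|[J2 j2 r2]] := small o2.
      by apply: (IHN (D' o2)) => //; [exact: D'N | apply: (D'n0 o1)].
    set P := point_span (D' o1) J1 in r1; set Q := point_span (D' o2) J2 in r2.
    (* The sum loses no point of [j]: [o1] is still available in [Q], and all the others in [P]. *)
    have hU : (point_span D (J1 :|: J2) <= P + Q)%MS.
      apply: point_span_subP => i o iJ oD.
      have [ij|ij] := eqVneq i j; last first.
        move: iJ; rewrite inE => /orP[iJ|iJ].
          apply: submx_trans (addsmxSl _ _); apply: sub_point_span => //.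
          by rewrite /D' (negPf ij).
        apply: submx_trans (addsmxSr _ _); apply: sub_point_span => //.
        by rewrite /D' (negPf ij).
      have [oo1|oo1] := eqVneq o o1; last first.
        apply: submx_trans (addsmxSl _ _); apply: sub_point_span; rewrite ?ij //.
        by rewrite /D' eqxx !inE oo1 -ij.
      apply: submx_trans (addsmxSr _ _); apply: sub_point_span; rewrite ?ij //.
      by rewrite /D' eqxx !inE -ij oD oo1 o12.
    have hI : (point_span D ((J1 :&: J2) :\ j) <= P :&: Q)%MS.
      apply: point_span_subP => i o; rewrite !inE => /and3P[ij i1 i2] oD.
      by rewrite sub_capmx !sub_point_span ?/D' ?(negPf ij).
    (* The two violations add up to at most 2r - 2. The dimension formula for [P] and [Q] turns this
       into a bound for the union and the intersection, and removing [j] adds only 1 to it, while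
       [hD] demands 2r. *)
    have := hD (J1 :|: J2); have := hD ((J1 :&: J2) :\ j).
    have := mxrankS hU; have := mxrankS hI; have := mxrank_sum_cap P Q.
    have c1 : (#|~: (J1 :|: J2)| + #|~: (J1 :&: J2)| = #|~: J1| + #|~: J2|)%N.
      by rewrite setCU setCI addnC cardsUI.
    have c2 : #|~: ((J1 :&: J2) :\ j)| = #|~: (J1 :&: J2)|.+1.
      have := cardsC (J1 :&: J2); have := cardsC ((J1 :&: J2) :\ j).
      have := cardsD1 j (J1 :&: J2); rewrite in_setI j1 j2 /= => -> <-.
      by rewrite add1n addSn -addnS => /addnI->.
    rewrite c2; lia.
  have g1 j : exists o, o \in D j by apply/set0Pn.
  pose g j := xchoose (g1 j); exists g.
  rewrite (leq_trans (hD setT)) // setCT cards0 addn0 mxrankS //.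
  apply: point_span_subP => j o _ oD.
  have -> : o = g j.
    have /forallP/(_ j) : [forall j, ~~ (1 < #|D j|)%N] by rewrite -negb_exists.
    rewrite -leqNgt => /card_le1P/(_ _ oD) Do.
    by have := xchooseP (g1 j); rewrite Do inE => /eqP.
  by rewrite -(rowK (fun j => x j (g j)) j) row_sub.
(* With no points at all, nonemptiness of the [D j] leaves no index [j]. *)
have g1 j : exists o, o \in D j by apply/set0Pn.
exists (fun j => xchoose (g1 j)); rewrite (leq_trans (hD setT)) //.
rewrite setCT cards0 addn0 mxrankS //; apply: point_span_subP => j o _ oD.
move: leN; rewrite leqn0 sum_nat_eq0 => /forallP/(_ j)/=.
by rewrite cards_eq0 (negPf (Dn0 j)).
Qed.
End Rado.

(** * Completions of affine matrices *)

Section AffinePolynomials.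
Variables (F : fieldType) (k : nat).
Local Notation P := {mpoly F[k]}.

Definition affine_mx m n (M : 'M[P]_(m, n)) : Prop :=
  forall i j, (msize (M i j) <= 2)%N.

Lemma affine_mpolyE (p : P) : (msize p <= 2)%N ->
  p = (p@_0%MM)%:MP + \sum_l p@_U_(l) *: 'X_l.
Proof.
move=> sp; apply/mpolyP => mon.
rewrite mcoeffD mcoeffC raddf_sum /=.
have [|mon2] := leqP (mdeg mon) 1; last first.
  rewrite memN_msupp_eq0; last first.
    by apply/negP => /msize_mdeg_lt; rewrite ltnNge (leq_trans sp).
  rewrite (_ : (mon == 0%MM) = false) ?mulr0 ?add0r; last first.
    by apply/negbTE; apply: contraTneq mon2 => ->; rewrite mdeg0.
  rewrite big1 // => l _; rewrite mcoeffZ mcoeffX.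
  by case: eqP mon2 => [<-|]; rewrite ?mdeg1 // mulr0.
rewrite leq_eqVlt ltnS leqn0 mdeg_eq0 => /orP[/mdeg1P[l /eqP->]|/eqP->].
  rewrite (_ : (U_(l)%MM == 0%MM) = false) ?mulr0 ?add0r; last first.
    by apply/negbTE/eqP => /(congr1 mdeg); rewrite mdeg1 mdeg0.
  rewrite (bigD1 l) //= big1 ?addr0; first by rewrite mcoeffZ mcoeffX eqxx mulr1.
  move=> l' l'l; rewrite mcoeffZ mcoeffX; case: eqP; last by rewrite mulr0.
  by move/mnmP/(_ l); rewrite !mnmE eqxx (negPf l'l).
rewrite eqxx mulr1 big1 ?addr0 // => l _; rewrite mcoeffZ mcoeffX.
case: eqP; last by rewrite mulr0.
by move/(congr1 mdeg); rewrite mdeg0 mdeg1.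
Qed.

Lemma affine_mevalE (p : P) (v : 'I_k -> F) : (msize p <= 2)%N ->
  p.@[v] = p@_0%MM + \sum_l v l * p@_U_(l).
Proof.
move=> sp; rewrite {1}(affine_mpolyE sp) mevalD mevalC raddf_sum /=.
congr (_ + _); apply: eq_bigr => l _.
by rewrite mevalZ mevalXU mulrC.
Qed.

(** The origin and the coordinate vectors: an affine polynomial is determined by its values there,
    even over the field with two elements. *)
Definition base_val : 'I_k -> F := fun=> 0.
Definition unit_val (l : 'I_k) : 'I_k -> F := fun l' => (l == l')%:R.

Lemma meval_base_val (p : P) : (msize p <= 2)%N -> p.@[base_val] = p@_0%MM.
Proof.
by move/affine_mevalE ->; rewrite big1 ?addr0 // => l _; rewrite mul0r.
Qed.

Lemma meval_unit_val (p : P) l : (msize p <= 2)%N ->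
  p.@[unit_val l] = p@_0%MM + p@_U_(l).
Proof.
move/affine_mevalE ->; rewrite (bigD1 l) //= /unit_val eqxx mul1r big1 ?addr0 //.
by move=> l' ll'; rewrite eq_sym (negPf ll') mul0r.
Qed.

Lemma affine_mx_ext m n (M N : 'M[P]_(m, n)) :
  affine_mx M -> affine_mx N ->
  (forall v, completion M v = completion N v) -> M = N.
Proof.
move=> aM aN MN; apply/matrixP => i j.
have E v : (M i j).@[v] = (N i j).@[v].
  by have /matrixP/(_ i j) := MN v; rewrite !mxE.
have E0 : (M i j)@_0%MM = (N i j)@_0%MM.
  by have := E base_val; rewrite !meval_base_val.
rewrite (affine_mpolyE (aM i j)) (affine_mpolyE (aN i j)) E0.
congr (_ + _); apply: eq_bigr => l _; congr (_ *: _).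
by have := E (unit_val l); rewrite !meval_unit_val // E0 => /addrI.
Qed.

Lemma completion_affineE m n (M : 'M[P]_(m, n)) v : affine_mx M ->
  completion M v = completion M base_val +
    \sum_l v l *: (completion M (unit_val l) - completion M base_val).
Proof.
move=> aM; apply/matrixP => i j; rewrite !mxE summxE affine_mevalE //.
rewrite meval_base_val //; congr (_ + _); apply: eq_bigr => l _.
by rewrite !mxE meval_unit_val // meval_base_val // addrC addKr.
Qed.

Lemma completionM_l m m' n (R : 'M[F]_(m', m)) (M : 'M[P]_(m, n)) v :
  completion (cst_mx k R *m M) v = R *m completion M v.
Proof.
rewrite /completion /cst_mx map_mxM; congr (_ *m _); apply/matrixP => i j.
by rewrite !mxE /= mevalC.
Qed.

Lemma completionM_r m n n' (M : 'M[P]_(m, n)) (Q : 'M[F]_(n, n')) v :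
  completion (M *m cst_mx k Q) v = completion M v *m Q.
Proof.
rewrite /completion /cst_mx map_mxM; congr (_ *m _); apply/matrixP => i j.
by rewrite !mxE /= mevalC.
Qed.

Lemma cst_mxM m n p (A : 'M[F]_(m, n)) (B : 'M[F]_(n, p)) :
  cst_mx k (A *m B) = cst_mx k A *m cst_mx k B.
Proof. exact: map_mxM. Qed.

Lemma cst_mx1 n : cst_mx k (1%:M : 'M[F]_n) = 1%:M.
Proof. exact: map_mx1. Qed.

Lemma cst_mx_block m1 m2 n1 n2 (A : 'M[F]_(m1, n1)) (B : 'M[F]_(m1, n2))
    (C : 'M[F]_(m2, n1)) (D : 'M[F]_(m2, n2)) :
  cst_mx k (block_mx A B C D) =
  block_mx (cst_mx k A) (cst_mx k B) (cst_mx k C) (cst_mx k D).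
Proof. exact: map_block_mx. Qed.

Lemma cst_mx_perm n (s : {perm 'I_n}) :
  cst_mx k (perm_mx s : 'M[F]_n) = perm_mx s.
Proof. exact: map_perm_mx. Qed.

Lemma mulmx_perm_entry (A : pzSemiRingType) m n (M : 'M[A]_(m, n))
    (s : {perm 'I_n}) i j :
  (M *m perm_mx s) i j = M i ((s^-1)%g j).
Proof. by rewrite -[s in perm_mx s]invgK -col_permE mxE. Qed.

(* All that is used of the ACI condition on indeterminates: a choice of one
   valuation per column is realised by a single valuation. *)
Definition free_columns m n (M : 'M[P]_(m, n)) : Prop :=
  forall w : 'I_n -> 'I_k -> F, exists v,
    forall i j, completion M v i j = completion M (w j) i j.

Definition column_affine m n (M : 'M[P]_(m, n)) : Prop :=
  affine_mx M /\ free_columns M.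

Lemma is_ACI_column_affine m n (M : 'M[P]_(m, n)) : is_ACI M -> column_affine M.
Proof.
move=> [aM dM]; split=> // w.
pose occ (l : 'I_k) i j := has (fun mon : 'X_{1..k} => 0 < mon l)%N (msupp (M i j)).
have occP l i j : occ l i j -> occurs l (M i j).
  by move/hasP => [mon mM mon0]; exists mon.
(* Each indeterminate takes its value from the only column where it occurs, and 0 if it occurs
   nowhere. *)
pose v l := if [pick j | [exists i, occ l i j]] is Some j then w j l else 0.
exists v => i j; rewrite !mxE !mevalE !big_seq; apply: eq_bigr => mon mM.
congr (_ * _); apply: eq_bigr => l _.
have [->|] := posnP (mon l); first by rewrite !expr0.
move=> mon0; have oj : occ l i j by apply/hasP; exists mon.
congr (_ ^+ _); rewrite /v; case: pickP => [j' /existsP[i' oj']|/(_ j)/existsP[]].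
  by rewrite (dM l i' i j' j) //; apply: occP.
by exists i.
Qed.

Lemma column_affine_mulcst m m' n (R : 'M[F]_(m', m)) (M : 'M[P]_(m, n)) :
  column_affine M -> column_affine (cst_mx k R *m M).
Proof.
move=> [aM fM]; split=> [i j|w].
  rewrite mxE (leq_trans (msize_sum _ _ _)) //; apply/bigmax_leqP => l _.
  by rewrite mxE mul_mpolyC (leq_trans (msizeZ_le _ _)).
have [v vP] := fM w; exists v => i j; rewrite !completionM_l !mxE.
by apply: eq_bigr => l _; rewrite vP.
Qed.

Lemma column_affine_mxsub m m' n n' (f : 'I_m' -> 'I_m) (g : 'I_n' -> 'I_n)
    (M : 'M[P]_(m, n)) :
  injective g -> column_affine M -> column_affine (mxsub f g M).
Proof.
move=> gI [aM fM]; split=> [i j|w]; first by rewrite mxE.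
(* Columns that are not selected may take any valuation; [base_val] is a placeholder. *)
pose w' j := if [pick j' | g j' == j] is Some j' then w j' else base_val.
have [v vP] := fM w'; exists v => i j.
have := vP (f i) (g j); rewrite !mxE => ->; congr meval.
rewrite /w'; case: pickP => [j' /eqP/gI->//|/(_ j)].
by rewrite eqxx.
Qed.

Lemma column_affine_perm m n (M : 'M[P]_(m, n)) (Q : 'M[F]_n) :
  is_perm_mx Q -> column_affine M -> column_affine (M *m cst_mx k Q).
Proof.
move=> /is_perm_mxP[s ->] aM; rewrite cst_mx_perm.
have -> : M *m perm_mx s = mxsub id (s^-1)%g M.
  by apply/matrixP => i j; rewrite mulmx_perm_entry mxE.
by apply: column_affine_mxsub => //; apply: perm_inj.
Qed.

Section Submatrices.
Variables (m1 m2 n1 n2 : nat) (M : 'M[P]_(m1 + m2, n1 + n2)).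
Hypothesis aM : column_affine M.

Lemma column_affine_ulsubmx : column_affine (ulsubmx M).
Proof.
rewrite (_ : ulsubmx M = mxsub (lshift m2) (lshift n2) M).
  by apply: column_affine_mxsub => //; apply: lshift_inj.
by apply/matrixP => i j; rewrite !mxE.
Qed.

Lemma column_affine_drsubmx : column_affine (drsubmx M).
Proof.
rewrite (_ : drsubmx M = mxsub (@rshift m1 m2) (@rshift n1 n2) M).
  by apply: column_affine_mxsub => //; apply: rshift_inj.
by apply/matrixP => i j; rewrite !mxE.
Qed.
End Submatrices.

End AffinePolynomials.

(** * Constant columns and separating rows *)

Section TriangularForms.
Variables (F : fieldType) (k : nat).
Local Notation P := {mpoly F[k]}.

Section Directions.
Variables (p q : nat) (N : 'M[P]_(p, q)).
Hypothesis aN : column_affine N.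

(** The vector of coefficients of the indeterminate [l] in column [j]. These vectors span the
    direction of the affine space over which the column ranges. *)
Definition column_direction j l : 'cV[F]_p :=
  col j (completion N (unit_val F l)) - col j (completion N (base_val F (k := k))).

Lemma col_completionE j v :
  col j (completion N v) =
  col j (completion N (base_val F (k := k))) + \sum_l v l *: column_direction j l.
Proof.
rewrite (completion_affineE v aN.1) raddfD raddf_sum /=; congr (_ + _).
by apply: eq_bigr => l _; rewrite linearZ raddfB.
Qed.

(** Otherwise every column moves in some direction or vanishes at the origin. A row [y] that is
    nonzero on one chosen vector [d j] per column can then be made to vanish on each column
    separately, hence on all at once by independence of the columns. This contradicts full row
    rank. *)
Lemma exists_constant_column (s : seq F) :
  uniq s -> (q <= size s)%N -> (0 < p)%N ->
  (forall v, \rank (completion N v) = p) ->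
  exists j (a : 'cV_p), a != 0 /\ forall v, col j (completion N v) = a.
Proof.
move=> us qs p0 rN; set c := completion N (base_val F (k := k)).
have [/existsP[j /andP[/forallP dj cj]]|] :=
  boolP [exists j, [forall l, column_direction j l == 0] && (col j c != 0)].
  exists j, (col j c); split=> // v; rewrite col_completionE big1 ?addr0 // => l _.
  by rewrite (eqP (dj l)) scaler0.
move/existsPn => cst0.
have q0 : (0 < q)%N.
  by rewrite (leq_trans p0) // -(rN (base_val F (k := k))) rank_leq_col.
have /fin_all_exists[d dP] : forall j : 'I_q, exists d : 'cV[F]_p, d != 0 /\
    forall phi : 'rV_p, (phi *m d) 0 0 != 0 ->
      exists w, phi *m col j (completion N w) = 0.
  move=> j; have := cst0 j; rewrite negb_and negbK.
  case/orP => [/forallPn[l dl]|/eqP cj0].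
    exists (column_direction j l); split=> // phi phid.
    (* Only [l] is moved, by the amount that cancels the value of [phi] at the origin. *)
    exists (fun l' => if l' == l then
      - (phi *m col j c) 0 0 / (phi *m column_direction j l) 0 0 else 0).
    rewrite col_completionE (bigD1 l) //= eqxx big1 ?addr0; last first.
      by move=> l' /negPf->; rewrite scale0r.
    rewrite mulmxDr -scalemxAr; apply/matrixP => x y.
    by rewrite !ord1 [LHS]mxE [X in _ + X]mxE divfK // addrN mxE.
  (* The column is already zero at the origin, so any nonzero vector can stand in for [d j]. *)
  exists (const_mx 1); split.
    by apply/cV0Pn; exists (Ordinal p0); rewrite mxE oner_neq0.
  by move=> phi _; exists (base_val F (k := k)); rewrite cj0 mulmx0.
have [y yP] : exists y : 'rV_p, forall j, (y *m \matrix_(i, j) d j i 0) 0 j != 0.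
  apply: (exists_nowhere_zero_combination us qs) => j.
  suff -> : col j (\matrix_(i, j) d j i 0) = d j by case: (dP j).
  by apply/colP => i; rewrite !mxE.
have yd j : (y *m \matrix_(i, j) d j i 0) 0 j = (y *m d j) 0 0.
  by rewrite [LHS]mxE [RHS]mxE; apply: eq_bigr => i _; rewrite mxE.
have /fin_all_exists[w wP] : forall j, exists w, y *m col j (completion N w) = 0.
  by move=> j; apply: (dP j).2; rewrite -yd.
have [v vP] := aN.2 w.
have yN0 : y *m completion N v = 0.
  apply/rowP => j; transitivity ((y *m col j (completion N (w j))) 0 0).
    by rewrite [LHS]mxE [RHS]mxE; apply: eq_bigr => i _; rewrite vP [in RHS]mxE.
  by rewrite wP !mxE.
have free : row_free (completion N v) by rewrite /row_free rN.
have := yP (Ordinal q0); rewrite yd.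
by move/eqP: yN0; rewrite mulmx_free_eq0 // => /eqP->; rewrite mul0mx mxE eqxx.
Qed.

(** The columns are compared modulo the span of all directions. If every linear relation among them
    has coefficient 0 at some [j], a functional killing all directions separates column [j].
    Otherwise some relation has all coefficients nonzero, and a completion turns it into a relation
    among actual columns, against full column rank. *)
Lemma exists_separating_row (s : seq F) :
  uniq s -> (q <= size s)%N -> (0 < q)%N ->
  (forall v, \rank (completion N v) = q) ->
  exists j (phi : 'rV_p), forall v, phi *m completion N v = delta_mx 0 j.
Proof.
move=> us qs q0 rN; set c := completion N (base_val F (k := k)).
pose G := \matrix_(x < #|{: 'I_q * 'I_k}|)
  (column_direction (enum_val x).1 (enum_val x).2)^T.
have dG j l : ((column_direction j l)^T <= G)%MS.
  have -> : (column_direction j l)^T = row (enum_rank (j, l)) G.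
    by rewrite rowK enum_rankK.
  exact: row_sub.
(* Row [j] of [B] is the base value of column [j] modulo the row space of [G], and [kermx B] is the
   space of relations. *)
pose B := c^T *m cokermx G.
have [/existsP[j /eqP Aj]|/existsPn nz] := boolP [exists j, col j (kermx B) == 0].
  have [Y YE] := mulmx_solvable (etrans (esym (colE j _)) Aj).
  exists j, (cokermx G *m Y)^T => v; apply: trmx_inj.
  rewrite trmx_mul trmxK trmx_delta YE [LHS]mulmxA; congr (_ *m _).
  apply/row_matrixP => i; rewrite !row_mul -!tr_col col_completionE.
  rewrite [(_ + _)^T]linearD raddf_sum mulmxDl mulmx_suml big1 ?addr0 // => l _.
  by apply/eqP; rewrite -submxE /= [(_ *: _)^T]linearZ scalemx_sub ?dG.
have [y yP] := exists_nowhere_zero_combination us qs nz.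
set kap := y *m kermx B in yP.
have kapB : kap *m c^T *m cokermx G = 0.
  by rewrite -mulmxA -/B -mulmxA mulmx_ker mulmx0.
have /submxP[D DE] : (kap *m c^T <= G)%MS by rewrite submxE kapB.
(* Column [j] enters the relation with weight [kap 0 j]. Dividing by it lets this column absorb its
   own share of the combination [D] of directions. *)
pose w j l := - D 0 (enum_rank (j, l)) / kap 0 j.
have [v vP] := aN.2 w.
have kN : kap *m (completion N v)^T = 0.
  have rowE' j : row j (completion N v)^T = (col j c)^T +
      \sum_l w j l *: (column_direction j l)^T.
    transitivity (col j (completion N (w j)))^T.
      by apply/rowP => i; rewrite [LHS]mxE [LHS]mxE vP [RHS]mxE [RHS]mxE.
    rewrite col_completionE [(_ + _)^T]linearD raddf_sum; congr (_ + _).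
    by apply: eq_bigr => l _; rewrite /= [(_ *: _)^T]linearZ.
  rewrite mulmx_sum_row.
  under eq_bigr => j _ do rewrite rowE' scalerDr scaler_sumr tr_col.
  rewrite big_split /= -mulmx_sum_row DE mulmx_sum_row.
  rewrite (reindex (@enum_rank _)) /=; last first.
    by exists enum_val => x _; rewrite ?enum_rankK ?enum_valK.
  rewrite pair_bigA -big_split big1 // => -[j l] _ /=.
  by rewrite rowK enum_rankK scalerA /w mulrC divfK // scaleNr addrN.
have free : row_free (completion N v)^T by rewrite /row_free mxrank_tr rN.
have := yP (Ordinal q0).
by move/eqP: kN; rewrite mulmx_free_eq0 // => /eqP->; rewrite mxE eqxx.
Qed.
End Directions.
(** A nonzero row has rank 1, so it is a nonzero scalar multiple of the first row of its invertible
    [row_ebase]. *)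
Lemma exists_unit_with_row0 p (phi : 'rV[F]_p.+1) :
  phi != 0 -> exists2 R, R \in unitmx & row 0 R = phi.
Proof.
move=> phi0; have r1 : \rank phi = 1%N by rewrite rank_rV phi0.
exists (col_ebase phi 0 0 *: row_ebase phi).
  rewrite unitmxZ ?row_ebase_unit // unitfE.
  have := col_ebase_unit phi; rewrite unitmxE det_mx11 unitfE //.
rewrite -[in RHS](mulmx_ebase phi) r1 linearZ /= rowE.
rewrite [in RHS](mx11_scalar (col_ebase phi)) -mulmxA mul_scalar_mx.
congr (_ *: (_ *m _)); apply/matrixP => i j; rewrite !mxE !ord1 /=.
by case: j => [[|j] lj].
Qed.

Lemma exists_unit_to_delta p (a : 'cV[F]_p.+1) :
  a != 0 -> exists2 R, R \in unitmx & R *m a = delta_mx 0 0.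
Proof.
move=> a0; have [|R uR Ra] := @exists_unit_with_row0 p a^T.
  by rewrite trmx_eq0.
exists (invmx R^T); first by rewrite unitmx_inv unitmx_tr.
rewrite -[a]trmxK -Ra tr_row colE mulmxA mulVmx ?unitmx_tr //.
by rewrite mul1mx.
Qed.

Lemma is_perm_mx_block (A : pzSemiRingType) n1 n2 (Q1 : 'M[A]_n1) (Q2 : 'M[A]_n2) :
  is_perm_mx Q1 -> is_perm_mx Q2 -> is_perm_mx (block_mx Q1 0 0 Q2).
Proof.
move=> /is_perm_mxP[s1 ->] /is_perm_mxP[s2 ->].
pose f (j : 'I_(n1 + n2)) : 'I_(n1 + n2) :=
  match split j with inl i => lshift n2 (s1 i) | inr i => rshift n1 (s2 i) end.
have fl i : f (lshift n2 i) = lshift n2 (s1 i) by rewrite /f (unsplitK (inl i)).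
have fr i : f (rshift n1 i) = rshift n1 (s2 i) by rewrite /f (unsplitK (inr i)).
have fI : injective f.
  move=> x y; case: (split_ordP x) => i ->; case: (split_ordP y) => j ->;
    rewrite ?fl ?fr => /eqP; rewrite ?eq_lshift ?eq_rshift ?eq_lrshift ?eq_rlshift //.
    by move/eqP/perm_inj->.
  by move/eqP/perm_inj->.
apply/is_perm_mxP; exists (perm fI); apply/matrixP => x y.
rewrite [RHS]mxE [in RHS]mxE permE.
case: (split_ordP x) => i ->; case: (split_ordP y) => j ->; rewrite ?fl ?fr
  ?block_mxEul ?block_mxEur ?block_mxEdl ?block_mxEdr !mxE
  ?eq_lshift ?eq_rshift ?eq_lrshift ?eq_rlshift //.
Qed.
End TriangularForms.

(** * Unitriangular forms *)

Section TriangularForms.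
Variables (F : fieldType) (k : nat).
Local Notation P := {mpoly F[k]}.

Lemma mxrank_completion_equiv m n (R : 'M[F]_m) (Q : 'M[F]_n) (M : 'M[P]_(m, n)) v :
  R \in unitmx -> is_perm_mx Q ->
  \rank (completion (cst_mx k R *m M *m cst_mx k Q) v) = \rank (completion M v).
Proof.
move=> uR /is_perm_mxP[s ->].
rewrite completionM_r completionM_l mxrankMfree ?row_free_unit ?unitmx_perm //.
by rewrite -mxrank_tr trmx_mul mxrankMfree ?mxrank_tr ?row_free_unit ?unitmx_tr.
Qed.

Lemma column_affine_equiv m n (R : 'M[F]_m) (Q : 'M[F]_n) (M : 'M[P]_(m, n)) :
  is_perm_mx Q -> column_affine M ->
  column_affine (cst_mx k R *m M *m cst_mx k Q).
Proof. by move=> pQ aM; apply/column_affine_perm/column_affine_mulcst. Qed.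

Lemma completion_block m1 m2 n1 n2 (A : 'M[P]_(m1, n1)) (B : 'M[P]_(m1, n2))
    (C : 'M[P]_(m2, n1)) (D : 'M[P]_(m2, n2)) v :
  completion (block_mx A B C D) v =
  block_mx (completion A v) (completion B v) (completion C v) (completion D v).
Proof. exact: map_block_mx. Qed.

Lemma completion0 m n v : completion (0 : 'M[P]_(m, n)) v = 0.
Proof. exact: map_mx0. Qed.

Lemma completion1 n v : completion (1%:M : 'M[P]_n) v = 1%:M.
Proof. exact: map_mx1. Qed.

Lemma completion_const m n (f : 'I_m -> 'I_n -> bool) v :
  completion (\matrix_(i, j) (f i j)%:R : 'M[P]_(m, n)) v = \matrix_(i, j) (f i j)%:R.
Proof. by apply/matrixP => i j; rewrite !mxE; case: f; rewrite ?meval1 ?meval0. Qed.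

Lemma affine_const m n (f : 'I_m -> 'I_n -> bool) :
  affine_mx (\matrix_(i, j) (f i j)%:R : 'M[P]_(m, n)).
Proof. by move=> i j; rewrite mxE; case: f; rewrite ?msize1 ?msize0. Qed.

(** Carries zeros and ones seen in all completions back to the polynomial entries. The maps [f] and
    [g] select a column, a row or a single entry. *)
Lemma affine_entries_const m n m' n' (N : 'M[P]_(m, n)) (f : 'I_m' -> 'I_m)
    (g : 'I_n' -> 'I_n) (b : 'I_m' -> 'I_n' -> bool) :
  affine_mx N ->
  (forall v i j, completion N v (f i) (g j) = (b i j)%:R) ->
  forall i j, N (f i) (g j) = (b i j)%:R.
Proof.
move=> aN Nb i j.
have /matrixP/(_ i j) : mxsub f g N = \matrix_(i, j) (b i j)%:R.
  apply: affine_mx_ext => [x y||v]; rewrite ?mxE //; first exact: affine_const.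
  by rewrite completion_const; apply/matrixP => x y; have := Nb v x y; rewrite !mxE.
by rewrite !mxE.
Qed.

Lemma block_mx_col0 (A : pzSemiRingType) m n (N : 'M[A]_(1 + m, 1 + n)) :
  (forall i, N i 0 = (i == 0)%:R) ->
  N = block_mx 1%:M (ursubmx N) 0 (drsubmx N).
Proof.
move=> N0; rewrite -{1}(submxK N); congr block_mx; apply/matrixP => x y;
  rewrite !mxE !ord1 (_ : lshift n 0 = 0) ?N0 //; exact: val_inj.
Qed.

Lemma block_mx_row0 (A : pzSemiRingType) m n (N : 'M[A]_(1 + m, 1 + n)) :
  (forall j, N 0 j = (j == 0)%:R) ->
  N = block_mx 1%:M 0 (dlsubmx N) (drsubmx N).
Proof.
move=> N0; rewrite -{1}(submxK N); congr block_mx; apply/matrixP => x y;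
  rewrite !mxE !ord1 (_ : lshift m 0 = 0) ?N0 //; exact: val_inj.
Qed.

Lemma upper_unitriangular_block1 (A : pzSemiRingType) m n (B : 'M[A]_(1, n))
    (N : 'M[A]_(m, n)) :
  (forall (i : 'I_m) (j : 'I_n), (j <= i)%N -> N i j = (i == j :> nat)%:R) ->
  forall (i : 'I_(1 + m)) (j : 'I_(1 + n)), (j <= i)%N ->
    block_mx 1%:M B 0 N i j = (i == j :> nat)%:R.
Proof.
move=> NE i' j'; have [i ->|i ->] := split_ordP i';
  have [j ->|j ->] := split_ordP j'; rewrite ?ord1 //.
- by rewrite block_mxEul mxE.
- by rewrite block_mxEdl mxE.
- by rewrite block_mxEdr /= eqSS => ij; apply: NE.
Qed.

Lemma lower_unitriangular_block1 (A : pzSemiRingType) m n (B : 'M[A]_(m, 1))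
    (N : 'M[A]_(m, n)) :
  (forall (i : 'I_m) (j : 'I_n), (i <= j)%N -> N i j = (i == j :> nat)%:R) ->
  forall (i : 'I_(1 + m)) (j : 'I_(1 + n)), (i <= j)%N ->
    block_mx 1%:M 0 B N i j = (i == j :> nat)%:R.
Proof.
move=> NE i' j'; have [i ->|i ->] := split_ordP i';
  have [j ->|j ->] := split_ordP j'; rewrite ?ord1 //.
- by rewrite block_mxEul mxE.
- by rewrite block_mxEur mxE.
- by rewrite block_mxEdr /= eqSS => ij; apply: NE.
Qed.

(** A constant nonzero column is moved to the front and turned into the first unit vector. The lower
    right block again has constant full row rank, so induction on [p] applies. *)
Lemma full_row_rank_upper_form (s : seq F) p q (N : 'M[P]_(p, q)) :
  uniq s -> (q <= size s)%N -> column_affine N ->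
  (forall v, \rank (completion N v) = p) ->
  exists (R : 'M[F]_p) (Q : 'M[F]_q), [/\ R \in unitmx, is_perm_mx Q &
    forall (i : 'I_p) (j : 'I_q), (j <= i)%N ->
      (cst_mx k R *m N *m cst_mx k Q) i j = (i == j :> nat)%:R].
Proof.
move=> us; elim: p q N => [|p IHp] q N qs aN rN.
  exists 1%:M, 1%:M; split; rewrite ?unitmx1 ?is_perm_mx1 //.
  by case.
have [j [a [a0 Na]]] := exists_constant_column aN us qs (ltn0Sn p) rN.
case: q N qs aN rN j Na => [|q] N qs aN rN j Na; first by case: j {Na}.
have [R0 uR0 R0a] := exists_unit_to_delta a0.
pose Q0 : 'M[F]_(1 + q) := perm_mx (tperm 0 j).
have pQ0 : is_perm_mx Q0 by apply: perm_mx_is_perm.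
pose N1 : 'M[P]_(1 + p, 1 + q) := cst_mx k R0 *m N *m cst_mx k Q0.
have aN1 : column_affine N1 by apply: column_affine_equiv.
have rN1 v : \rank (completion N1 v) = p.+1 by rewrite mxrank_completion_equiv.
have N1c v i : completion N1 v i 0 = (i == 0)%:R.
  rewrite completionM_r completionM_l mulmx_perm_entry tpermV tpermL.
  have -> : (R0 *m completion N v) i j = (R0 *m col j (completion N v)) i 0.
    by rewrite [LHS]mxE [RHS]mxE; apply: eq_bigr => l _; rewrite [in RHS]mxE.
  by rewrite Na R0a mxE eqxx andbT.
have N1E i : N1 i 0 = (i == 0)%:R.
  exact: (@affine_entries_const _ _ _ 1 N1 id (fun=> 0) (fun i _ => i == 0) aN1.1
    (fun v x _ => N1c v x) i 0).
have N1b : N1 = block_mx 1%:M (ursubmx N1) 0 (drsubmx N1) by apply: block_mx_col0.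
have [|v|R' [Q' [uR' pQ' N'P]]] := IHp q (drsubmx N1) (ltnW qs).
- exact: column_affine_drsubmx.
- have := rN1 v; rewrite {1}N1b completion_block completion1 completion0.
  by rewrite mxrank_ublock_row_free ?row_free_unit ?unitmx1 // => -[].
pose BR : 'M[F]_(1 + p) := block_mx 1%:M 0 0 R'.
pose BQ : 'M[F]_(1 + q) := block_mx 1%:M 0 0 Q'.
exists (BR *m R0), (Q0 *m BQ); split.
- rewrite unitmx_mul uR0 andbT unitmxE (det_ublock (1%:M : 'M_1)) det1 mul1r.
  by rewrite -unitmxE.
- by rewrite is_perm_mxMl //; apply: (@is_perm_mx_block _ 1 q); rewrite ?is_perm_mx1.
have -> : cst_mx k (BR *m R0) *m N *m cst_mx k (Q0 *m BQ) =
    cst_mx k BR *m N1 *m cst_mx k BQ by rewrite !cst_mxM /N1 !mulmxA.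
have -> : cst_mx k BR *m N1 *m cst_mx k BQ =
    block_mx 1%:M (ursubmx N1 *m cst_mx k Q') 0
      (cst_mx k R' *m drsubmx N1 *m cst_mx k Q').
  rewrite {1}N1b !cst_mx_block !cst_mx1 /cst_mx !map_mx0 !mulmx_block.
  by rewrite !(mul1mx, mulmx1, mul0mx, mulmx0, add0r, addr0).
exact: upper_unitriangular_block1.
Qed.

(** A separating functional becomes the first row of the row transformation, so the first row of the
    matrix is a unit row once its column is moved to the front. Induction on [q] treats the lower
    right block. *)
Lemma full_column_rank_lower_form (s : seq F) p q (N : 'M[P]_(p, q)) :
  uniq s -> (q <= size s)%N -> column_affine N ->
  (forall v, \rank (completion N v) = q) ->
  exists (R : 'M[F]_p) (Q : 'M[F]_q), [/\ R \in unitmx, is_perm_mx Q &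
    forall (i : 'I_p) (j : 'I_q), (i <= j)%N ->
      (cst_mx k R *m N *m cst_mx k Q) i j = (i == j :> nat)%:R].
Proof.
move=> us; elim: q p N => [|q IHq] p N qs aN rN.
  exists 1%:M, 1%:M; split; rewrite ?unitmx1 ?is_perm_mx1 //.
  by move=> i [].
have [j [phi Nphi]] := exists_separating_row aN us qs (ltn0Sn q) rN.
have p0 : (0 < p)%N.
  by rewrite (leq_trans (ltn0Sn q)) // -(rN (@base_val F k)) rank_leq_row.
case: p p0 N qs aN rN phi Nphi => [|p] // _ N qs aN rN phi Nphi.
have phi0 : phi != 0.
  apply/eqP => phi0; have /matrixP/(_ 0 j) := Nphi (@base_val F k).
  by rewrite phi0 mul0mx !mxE !eqxx => /eqP; rewrite eq_sym oner_eq0.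
have [R0 uR0 R0phi] := exists_unit_with_row0 phi0.
pose Q0 : 'M[F]_(1 + q) := perm_mx (tperm 0 j).
have pQ0 : is_perm_mx Q0 by apply: perm_mx_is_perm.
pose N1 : 'M[P]_(1 + p, 1 + q) := cst_mx k R0 *m N *m cst_mx k Q0.
have aN1 : column_affine N1 by apply: column_affine_equiv.
have rN1 v : \rank (completion N1 v) = q.+1 by rewrite mxrank_completion_equiv.
have N1c v l : completion N1 v 0 l = (l == 0)%:R.
  rewrite completionM_r completionM_l mulmx_perm_entry tpermV.
  have -> x : (R0 *m completion N v) 0 x = (row 0 R0 *m completion N v) 0 x.
    by rewrite -row_mul [RHS]mxE.
  rewrite R0phi Nphi mxE eqxx /=.
  by rewrite -[X in _ == X](tpermL 0 j) (inj_eq perm_inj).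
have N1E l : N1 0 l = (l == 0)%:R.
  exact: (@affine_entries_const _ _ 1 _ N1 (fun=> 0) id (fun _ x => x == 0) aN1.1
    (fun v _ x => N1c v x) 0 l).
have N1b : N1 = block_mx 1%:M 0 (dlsubmx N1) (drsubmx N1) by apply: block_mx_row0.
have [|v|R' [Q' [uR' pQ' N'P]]] := IHq p (drsubmx N1) (ltnW qs).
- exact: column_affine_drsubmx.
- have := rN1 v; rewrite {1}N1b completion_block completion1 completion0.
  rewrite -mxrank_tr tr_block_mx trmx1 trmx0.
  by rewrite mxrank_ublock_row_free ?row_free_unit ?unitmx1 // mxrank_tr => -[].
pose BR : 'M[F]_(1 + p) := block_mx 1%:M 0 0 R'.
pose BQ : 'M[F]_(1 + q) := block_mx 1%:M 0 0 Q'.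
exists (BR *m R0), (Q0 *m BQ); split.
- rewrite unitmx_mul uR0 andbT unitmxE (det_ublock (1%:M : 'M_1)) det1 mul1r.
  by rewrite -unitmxE.
- by rewrite is_perm_mxMl //; apply: (@is_perm_mx_block _ 1 q); rewrite ?is_perm_mx1.
have -> : cst_mx k (BR *m R0) *m N *m cst_mx k (Q0 *m BQ) =
    cst_mx k BR *m N1 *m cst_mx k BQ by rewrite !cst_mxM /N1 !mulmxA.
have -> : cst_mx k BR *m N1 *m cst_mx k BQ =
    block_mx 1%:M 0 (cst_mx k R' *m dlsubmx N1)
      (cst_mx k R' *m drsubmx N1 *m cst_mx k Q').
  rewrite {1}N1b !cst_mx_block !cst_mx1 /cst_mx !map_mx0 !mulmx_block.
  by rewrite !(mul1mx, mulmx1, mul0mx, mulmx0, add0r, addr0).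
exact: lower_unitriangular_block1.
Qed.

(** Reversing both rows and columns sends the lower triangular block at the top to an upper
    triangular one at the bottom, which starts at row [p - q]. *)
Lemma full_column_rank_upper_form (s : seq F) p q (N : 'M[P]_(p, q)) :
  uniq s -> (q <= size s)%N -> column_affine N ->
  (forall v, \rank (completion N v) = q) ->
  exists (R : 'M[F]_p) (Q : 'M[F]_q), [/\ R \in unitmx, is_perm_mx Q &
    forall (i : 'I_p) (j : 'I_q), (p - q + j <= i)%N ->
      (cst_mx k R *m N *m cst_mx k Q) i j = (i == (p - q + j)%N :> nat)%:R].
Proof.
move=> us qs aN rN.
have [R [Q [uR pQ NP]]] := full_column_rank_lower_form us qs aN rN.
have qp : (q <= p)%N by rewrite -(rN (@base_val F k)) rank_leq_row.
exists (perm_mx (perm (@rev_ord_inj p)) *m R), (Q *m perm_mx (perm (@rev_ord_inj q))).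
split; first by rewrite unitmx_mul unitmx_perm.
  by rewrite is_perm_mxMl // perm_mx_is_perm.
move=> i j ij; rewrite !cst_mxM !cst_mx_perm !mulmxA mulmx_perm_entry.
rewrite -!mulmxA -row_permE mxE permE mulmxA.
have -> : ((perm (@rev_ord_inj q))^-1)%g j = rev_ord j.
  by apply: (@perm_inj _ (perm (@rev_ord_inj q))); rewrite permKV permE rev_ordK.
have := ltn_ord i; have := ltn_ord j; move=> jq ip.
rewrite NP /=; last by lia.
by congr (_%:R); lia.
Qed.
End TriangularForms.

(** * Tight sets of columns *)

Section TightSets.
Variables (F : fieldType) (k m n : nat) (M : 'M[{mpoly F[k]}]_(m, n)).
Hypothesis aM : column_affine M.

(** Rado's theorem needs finitely many points. These samples suffice, since every value of an affine
    column lies in their span. *)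
Definition sample_val (o : option 'I_k) : 'I_k -> F :=
  if o is Some l then unit_val F l else @base_val F k.

Definition column_span (J : {set 'I_n}) : 'M[F]_m :=
  point_span (fun j o => (col j (completion M (sample_val o)))^T)
             (fun=> [set: option 'I_k]) J.

(** The submodular function rho. *)
Definition col_rank (J : {set 'I_n}) : nat := \rank (column_span J).

Lemma sub_column_span (J : {set 'I_n}) j v :
  j \in J -> ((col j (completion M v))^T <= column_span J)%MS.
Proof.
move=> jJ; have sJ o : ((col j (completion M (sample_val o)))^T <= column_span J)%MS.
  exact: (@sub_point_span _ _ _ _
    (fun j o => (col j (completion M (sample_val o)))^T) (fun=> setT)).
rewrite col_completionE // [(_ + _)^T]linearD raddf_sum addmx_sub ?(sJ None) //=.
apply: summx_sub => l _; rewrite [(_ *: _)^T]linearZ scalemx_sub //.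
  rewrite /= /column_direction [(_ - _)^T]linearB addmx_sub ?(sJ (Some l)) //.
  by rewrite eqmx_opp (sJ None).
Qed.

Lemma mxrank_completion_le (J : {set 'I_n}) v :
  (\rank (completion M v) <= col_rank J + #|~: J|)%N.
Proof.
rewrite -mxrank_tr.
have sub : ((completion M v)^T <= column_span J +
    \sum_(j in ~: J) <<(col j (completion M v))^T>>)%MS.
  apply/row_subP => j; rewrite -tr_col; have [jJ|jJ] := boolP (j \in J).
    by rewrite (submx_trans _ (addsmxSl _ _)) ?sub_column_span.
  rewrite (submx_trans _ (addsmxSr _ _)) // (sumsmx_sup j) ?genmxE //.
  by rewrite inE.
rewrite (leq_trans (mxrankS sub)) // (leq_trans (mxrank_adds_leqif _ _).1) //.
rewrite leq_add2l (leq_trans (mxrank_sum_leqif _).1) //= -sum1_card.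
by apply: leq_sum => j _; rewrite genmxE mxrank_tr rank_leq_col.
Qed.

Variable r : nat.
Hypothesis rM : forall v, \rank (completion M v) = r.

Definition tight (J : {set 'I_n}) : Prop := (col_rank J + #|~: J|)%N = r.

Lemma tight_le (J : {set 'I_n}) : (col_rank J + #|~: J| <= r)%N -> tight J.
Proof.
move=> le; apply/eqP; rewrite /tight eqn_leq le.
by rewrite -(rM (@base_val F k)) mxrank_completion_le.
Qed.

(** If no set were tight, all the bounds would be at least [r.+1]. Rado's theorem would give a
    transversal of that rank, and independence of the columns realises it by one completion. *)
Lemma exists_tight : exists J, tight J.
Proof.
have [/forallP tr|/forallPn[J]] :=
  boolP [forall J : {set 'I_n}, r < col_rank J + #|~: J|]%N; last first.
  by rewrite -leqNgt => /tight_le; exists J.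
have [|g gP] := rado_transversal _ tr.
  by move=> j; apply/set0Pn; exists None; rewrite inE.
have [v vP] := aM.2 (fun j => sample_val (g j)).
move: gP; rewrite -(_ : (completion M v)^T = \matrix_j _) ?mxrank_tr ?rM ?ltnn //.
by apply/matrixP => j i; rewrite [LHS]mxE vP [RHS]mxE [RHS]mxE [RHS]mxE.
Qed.

Lemma column_spanU (J K : {set 'I_n}) :
  (column_span (J :|: K) <= column_span J + column_span K)%MS.
Proof.
apply: point_span_subP => j o; rewrite inE => /orP[jJ|jK] _.
  by rewrite (submx_trans _ (addsmxSl _ _)) // sub_column_span.
by rewrite (submx_trans _ (addsmxSr _ _)) // sub_column_span.
Qed.

Lemma column_spanS (J K : {set 'I_n}) :
  J \subset K -> (column_span J <= column_span K)%MS.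
Proof.
move=> JK; apply: point_span_subP => j o jJ _.
by rewrite sub_column_span ?(subsetP JK).
Qed.

(** By submodularity the bounds for union and intersection add up to at most 2r, while each of them
    is at least [r]. *)
Lemma tightUI (J K : {set 'I_n}) :
  tight J -> tight K -> tight (J :|: K) /\ tight (J :&: K).
Proof.
move=> tJ tK; have rk : (col_rank (J :|: K) + col_rank (J :&: K) <=
    col_rank J + col_rank K)%N.
  rewrite -(mxrank_sum_cap (column_span J) (column_span K)).
  apply: leq_add; apply: mxrankS; first exact: column_spanU.
  by rewrite sub_capmx !column_spanS ?subsetIl ?subsetIr.
have ck : (#|~: (J :|: K)| + #|~: (J :&: K)| = #|~: J| + #|~: K|)%N.
  by rewrite setCU setCI addnC cardsUI.
have lb L : (r <= col_rank L + #|~: L|)%N.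
  by rewrite -(rM (@base_val F k)) mxrank_completion_le.
have := lb (J :|: K); have := lb (J :&: K); rewrite /tight in tJ tK *; lia.
Qed.

(** After the change of basis [R], the values of the columns in [J] live in the first [d]
    coordinates. *)
Lemma col_rank_le (R : 'M[F]_m) (d : nat) (J : {set 'I_n}) :
  R \in unitmx ->
  (forall v (i : 'I_m) c, c \in J -> (d <= i)%N -> (R *m completion M v) i c = 0) ->
  (col_rank J <= d)%N.
Proof.
move=> uR R0; have uRT : R^T \in unitmx by rewrite unitmx_tr.
suff /mxrankS le : (column_span J <= (pid_mx d : 'M_m) *m invmx R^T)%MS.
  rewrite (leq_trans le) // (leq_trans (mxrankM_maxl _ _)) //.
  have [dm|/ltnW dm] := leqP d m; first by rewrite rank_pid_mx.
  exact: leq_trans (rank_leq_row _) dm.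
apply: point_span_subP => c o cJ _; set x := (col _ _)^T.
rewrite -[x](mulmxK uRT) submxMr //.
suff -> : x *m R^T = x *m R^T *m (pid_mx d : 'M_m) by rewrite submxMl.
apply/rowP => i; rewrite [RHS]mxE (bigD1 i) //= big1 ?addr0.
  rewrite [pid_mx _ _ _]mxE eqxx /=; have [|di] := ltnP i d; first by rewrite mulr1.
  rewrite mulr0; apply: etrans (R0 (sample_val o) i c cJ di).
  rewrite /x -trmx_mul [LHS]mxE.
  by rewrite [LHS]mxE [RHS]mxE; apply: eq_bigr => l _; rewrite [in LHS]mxE.
by move=> l li; rewrite [pid_mx _ _ _]mxE (inj_eq val_inj) (negPf li) mulr0.
Qed.
End TightSets.

(** * Row bases and column orders adapted to a chain *)

(** The annihilators satisfy [K2 <= K1]. The rows of [R] run through bases of a complement of [K1],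
    of a complement of [K2] in [K1], and of [K2], so their numbers are the successive differences of
    0, [\rank U1], [\rank U2] and [m]. *)
Lemma adapted_basis (F : fieldType) m (U1 U2 : 'M[F]_m) :
  (U1 <= U2)%MS ->
  exists R : 'M[F]_m, [/\ R \in unitmx,
    (forall i : 'I_m, (\rank U1 <= i)%N -> row i R *m U1^T = 0) &
    (forall i : 'I_m, (\rank U2 <= i)%N -> row i R *m U2^T = 0)].
Proof.
move=> U12; pose K1 := kermx U1^T; pose K2 := kermx U2^T.
have K21 : (K2 <= K1)%MS.
  apply/sub_kermxP; have /submxP[D ->] := U12.
  by rewrite trmx_mul mulmxA mulmx_ker mul0mx.
pose R0 := col_mx (row_base (K1^C)%MS)
  (col_mx (row_base (K1 :\: K2)%MS) (row_base K2)).
have r1 : \rank K1 = (m - \rank U1)%N by rewrite mxrank_ker mxrank_tr.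
have r2 : \rank K2 = (m - \rank U2)%N by rewrite mxrank_ker mxrank_tr.
have K12 : (K1 :&: K2 :=: K2)%MS by apply/capmx_idPr.
have r12 : (\rank (K1 :\: K2) + \rank K2 = \rank K1)%N.
  by rewrite -[in LHS]K12 addnC mxrank_cap_compl.
have rC : \rank (K1^C)%MS = \rank U1.
  by rewrite mxrank_compl r1 subKn ?rank_leq_row.
have U1m := rank_leq_row U1; have U2m := rank_leq_row U2.
have U12r := mxrankS U12.
have e : (\rank (K1^C)%MS + (\rank (K1 :\: K2)%MS + \rank K2) = m)%N by lia.
exists (castmx (e, erefl) R0).
have rowcE i : row i (castmx (e, erefl) R0) = row (cast_ord (esym e) i) R0.
  by apply/rowP => j; rewrite !mxE castmxE /= cast_ord_id mxE.
split=> [|i U1i|i U2i].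
- rewrite -row_full_unit -sub1mx eqmx_cast.
  have : (1%:M <= K1 + K1^C)%MS by rewrite submx_full ?addsmx_compl_full.
  move/submx_trans; apply; rewrite addsmx_sub -!addsmxE.
  rewrite [X in _ && X](submx_trans _ (addsmxSl _ _)) ?eq_row_base // andbT.
  rewrite (submx_trans _ (addsmxSr _ _)) // -addsmxE -(addsmx_diff_cap_eq K1 K2).
  by rewrite addsmxS ?eq_row_base ?K12.
- apply/sub_kermxP; rewrite rowcE.
  have : val (cast_ord (esym e) i) = i by [].
  have [j -> /= ij|j -> _] := split_ordP (cast_ord (esym e) i).
    by have := ltn_ord j; lia.
  rewrite rowKd (submx_trans (row_sub _ _)) // -addsmxE addsmx_sub !eq_row_base.
  by rewrite K21 diffmxSl.
- apply/sub_kermxP; rewrite rowcE.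
  have : val (cast_ord (esym e) i) = i by [].
  have [j -> /= ij|j -> /= ij] := split_ordP (cast_ord (esym e) i).
    by have := ltn_ord j; lia.
  rewrite rowKd; have [l jE|l jE] := split_ordP j.
    by have := ltn_ord l; move: ij; rewrite jE /=; lia.
  by rewrite jE rowKd (submx_trans (row_sub _ _)) ?eq_row_base.
Qed.


(** Each column goes to its position in the list of [J1], then the rest of [J2], then everything
    else. *)
Lemma exists_sorting_perm n (J1 J2 : {set 'I_n}) :
  J1 \subset J2 -> exists s : {perm 'I_n}, forall c,
    (s c < #|J1|)%N = (c \in J1) /\ (s c < #|J2|)%N = (c \in J2).
Proof.
move=> J12; pose t := enum J1 ++ enum (J2 :\: J1) ++ enum (~: J2).
have tc c : c \in t.
  by rewrite !mem_cat !mem_enum !inE; case: (c \in J2); case: (c \in J1).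
have cJ2 : (#|J1| + #|J2 :\: J1| = #|J2|)%N.
  by rewrite -(cardsID J1 J2) (setIidPr J12).
have st : size t = n.
  rewrite !size_cat -!cardE addnA cJ2 cardsC; exact: card_ord.
have idx c : (index c t < n)%N by rewrite -[ltnRHS]st index_mem.
pose f c := Ordinal (idx c).
have fI : injective f.
  by move=> c d /(congr1 val)/= e; rewrite -(nth_index c (tc c)) e nth_index.
exists (perm fI) => c; rewrite permE /= /t !index_cat !mem_enum !inE.
have [c1|c1] /= := boolP (c \in J1).
  rewrite (subsetP J12 _ c1) cardE index_mem mem_enum c1; split=> //.
  by rewrite -cJ2 ltn_addr // [ltnRHS]cardE index_mem mem_enum.
rewrite -cardE ltnNge leq_addr; split=> //.
have [c2|c2] /= := boolP (c \in J2).
  by rewrite -cJ2 ltn_add2l [ltnRHS]cardE index_mem mem_enum !inE c1.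
by rewrite -cardE addnA cJ2 ltnNge leq_addr.
Qed.

(** * Decompositions *)

Section Decompositions.
Variables (F : fieldType) (k : nat).
Local Notation P := {mpoly F[k]}.

Lemma has_decomp_equiv m n (M : 'M[P]_(m, n)) (R : 'M[F]_m) (Q : 'M[F]_n)
    m1 m2 m3 n1 n3 (W : 'M[P]_(m1, n1)) (S : 'M[P]_m2) (T : 'M[P]_(m3, n3)) :
  R \in unitmx -> is_perm_mx Q ->
  has_decomp (cst_mx k R *m M *m cst_mx k Q) W S T -> has_decomp M W S T.
Proof.
move=> uR pQ [R' [Q' [uR' [pQ' st]]]]; exists (R' *m R), (Q *m Q').
rewrite unitmx_mul uR' uR is_perm_mxMl //; split=> //; split=> //.
by rewrite !cst_mxM !mulmxA in st *.
Qed.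

Section Blocks.
Variables (m1 m2 m3 n1 n3 : nat).
Local Notation mat := 'M[P]_(m1 + (m2 + m3), n1 + (m2 + n3)).

Definition stair_mx (W : 'M[P]_(m1, n1)) X Y (S : 'M[P]_m2) Z
    (T : 'M[P]_(m3, n3)) : mat :=
  block_mx W (row_mx X Y) 0 (block_mx S Z 0 T).

Lemma completion_stair_mx W X Y S Z T v :
  completion (stair_mx W X Y S Z T) v =
  block_mx (completion W v) (completion (row_mx X Y) v) 0
    (block_mx (completion S v) (completion Z v) 0 (completion T v)).
Proof. by rewrite /stair_mx !completion_block !completion0. Qed.

(** Numerical positions replace block indices here, so that the zeros can be matched with columns
    moved by a permutation. *)
Lemma stair_mx_zeros W X Y S Z T
    (i : 'I_(m1 + (m2 + m3))) (j : 'I_(n1 + (m2 + n3))) :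
  ((j < n1) && (m1 <= i) || (j < n1 + m2) && (m1 + m2 <= i))%N ->
  stair_mx W X Y S Z T i j = 0.
Proof.
have [x ->|x ->] := split_ordP i; have [y ->|y ->] := split_ordP j => /=.
- by have := ltn_ord x; have := ltn_ord y; lia.
- by have := ltn_ord x; have := ltn_ord y; lia.
- by rewrite /stair_mx block_mxEdl mxE.
rewrite /stair_mx block_mxEdr.
have [x' ->|x' ->] := split_ordP x; have [y' ->|y' ->] := split_ordP y => /=.
- by have := ltn_ord x'; have := ltn_ord y'; lia.
- by have := ltn_ord x'; have := ltn_ord y'; lia.
- by rewrite block_mxEdl mxE.
- by have := ltn_ord x'; have := ltn_ord y'; lia.
Qed.

Lemma stair_mx_of_zeros (N : mat) :
  (forall (i : 'I_(m1 + (m2 + m3))) (j : 'I_(n1 + (m2 + n3))),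
    ((j < n1) && (m1 <= i) || (j < n1 + m2) && (m1 + m2 <= i))%N ->
    N i j = 0) ->
  N = stair_mx (ulsubmx N) (lsubmx (ursubmx N)) (rsubmx (ursubmx N))
        (ulsubmx (drsubmx N)) (ursubmx (drsubmx N)) (drsubmx (drsubmx N)).
Proof.
move=> N0; rewrite /stair_mx hsubmxK -[LHS]submxK; congr block_mx.
  by apply/matrixP => i j; rewrite !mxE N0 //= ltn_ord leq_addr.
rewrite -[LHS]submxK; congr block_mx.
by apply/matrixP => i j; rewrite !mxE N0 //=; have := ltn_ord j; lia.
Qed.

(** The given rank is the largest that the block shape allows, so each diagonal block must reach its
    own bound. *)
Lemma mxrank_stair (W : 'M[F]_(m1, n1)) X (S : 'M[F]_m2) Z (T : 'M[F]_(m3, n3)) :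
  \rank (block_mx W X 0 (block_mx S Z 0 T)) = (m1 + (m2 + n3))%N ->
  [/\ \rank W = m1, \rank S = m2 & \rank T = n3].
Proof.
move=> rN; have [le1 le2] := mxrank_ublock_le W X (block_mx S Z 0 T).
have [le3 le4] := mxrank_ublock_le S Z T.
have := rank_leq_row W; have := rank_leq_row S; have := rank_leq_col T.
have := rank_leq_col (block_mx S Z 0 T).
rewrite rN in le1 le2; split; lia.
Qed.

Lemma constant_rank_stair_decomp (s : seq F) W X Y S Z T :
  uniq s -> (n1 + (m2 + n3) <= size s)%N ->
  column_affine (stair_mx W X Y S Z T) ->
  (forall v, \rank (completion (stair_mx W X Y S Z T) v) = (m1 + (m2 + n3))%N) ->
  ((m1 < n1)%N \/ (m1 = 0%N /\ n1 = 0%N)) ->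
  ((n3 < m3)%N \/ (m3 = 0%N /\ n3 = 0%N)) ->
  exists (W' : 'M_(m1, n1)) (S' : 'M_m2) (T' : 'M_(m3, n3)),
    has_decomp (stair_mx W X Y S Z T) W' S' T'.
Proof.
move=> us ss aN rN hW hT; pose N := stair_mx W X Y S Z T.
have rk v : [/\ \rank (completion W v) = m1, \rank (completion S v) = m2 &
    \rank (completion T v) = n3].
  by have := rN v; rewrite completion_stair_mx => /mxrank_stair.
have aW : column_affine W.
  by have := column_affine_ulsubmx aN; rewrite /stair_mx block_mxKul.
have aD := column_affine_drsubmx aN; rewrite /stair_mx block_mxKdr in aD.
have aS : column_affine S by have := column_affine_ulsubmx aD; rewrite block_mxKul.
have aT : column_affine T by have := column_affine_drsubmx aD; rewrite block_mxKdr.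
have [||v|R1 [Q1 [uR1 pQ1 W']]] := @full_row_rank_upper_form F k s _ _ W us.
- lia.
- by [].
- by case: (rk v).
have [||v|R2 [Q2 [uR2 pQ2 S']]] := @full_row_rank_upper_form F k s _ _ S us.
- lia.
- by [].
- by case: (rk v).
have [||v|R3 [Q3 [uR3 pQ3 T']]] := @full_column_rank_upper_form F k s _ _ T us.
- lia.
- by [].
- by case: (rk v).
pose B := (cst_mx k R1 *m row_mx X Y) *m cst_mx k (block_mx Q2 0 0 Q3).
exists (cst_mx k R1 *m W *m cst_mx k Q1), (cst_mx k R2 *m S *m cst_mx k Q2).
exists (cst_mx k R3 *m T *m cst_mx k Q3).
exists (block_mx R1 0 0 (block_mx R2 0 0 R3)).
exists (block_mx Q1 0 0 (block_mx Q2 0 0 Q3)).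
split; first by rewrite !unitmxE !det_ublock !unitrM -!unitmxE uR1 uR2.
split; first by rewrite !is_perm_mx_block.
do 3!split=> //.
exists erefl, erefl, (lsubmx B), (rsubmx B), (cst_mx k R2 *m Z *m cst_mx k Q3).
rewrite castmx_id hsubmxK /B !cst_mx_block /cst_mx !map_mx0 /stair_mx.
by do 2!rewrite !mulmx_block !(mul1mx, mulmx1, mul0mx, mulmx0, add0r, addr0).
Qed.
End Blocks.

(** The last two hypotheses settle the boundary cases. For [r < n] tightness of [J1] makes the first
    block wide, but for [r = n] it would make it square, so the block has to be void. The last block
    behaves likewise with [m] and [J2]. *)
Lemma tight_decomp (s : seq F) m n (M : 'M[P]_(m, n)) r (J1 J2 : {set 'I_n}) :
  uniq s -> (n <= size s)%N -> column_affine M ->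
  (forall v, \rank (completion M v) = r) ->
  tight M r J1 -> tight M r J2 -> J1 \subset J2 ->
  (r = n -> J1 = set0) -> (r = m -> J2 = setT) ->
  exists (m1 m2 m3 n1 n3 : nat) (W : 'M[P]_(m1, n1)) (S : 'M[P]_m2)
    (T : 'M[P]_(m3, n3)), has_decomp M W S T /\ (m2 + #|J1|)%N = #|J2|.
Proof.
move=> us ns aM rM t1 t2 J12 hJ1 hJ2.
have [p pP] := exists_sorting_perm J12.
have [R [uR R1 R2]] := adapted_basis (column_spanS aM J12).
pose N := cst_mx k R *m M *m cst_mx k (perm_mx p).
have aN : column_affine N by apply/column_affine_equiv/aM/perm_mx_is_perm.
have rN v : \rank (completion N v) = r.
  by rewrite mxrank_completion_equiv ?perm_mx_is_perm.
have N0 (i : 'I_m) (j : 'I_n) : ((j < #|J1|) && (col_rank M J1 <= i) ||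
    (j < #|J2|) && (col_rank M J2 <= i))%N -> N i j = 0.
  move=> ij; pose c := (p^-1)%g j.
  have pc : p c = j by rewrite permKV.
  have z (J : {set 'I_n}) v : c \in J -> row i R *m (column_span M J)^T = 0 ->
      completion N v i j = 0.
    move=> cJ RJ; rewrite completionM_r completionM_l mulmx_perm_entry -/c.
    have /submxP[D DE] := sub_column_span aM v cJ.
    have : row i R *m col c (completion M v) = 0.
      by rewrite -[col _ _]trmxK DE trmx_mul mulmxA RJ mul0mx.
    move=> /matrixP/(_ 0 0); rewrite [RHS]mxE; apply: etrans.
    rewrite [LHS]mxE [RHS]mxE; apply: eq_bigr => l _.
    by rewrite [in RHS]mxE [in RHS]mxE.
  apply: (@affine_entries_const F k _ _ 1 1 N (fun=> i) (fun=> j) (fun _ _ => false)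
    aN.1 _ 0 0) => v _ _.
  case/orP: ij => /andP[jJ ij].
    by apply: (z J1); rewrite -?(pP c).1 ?pc // R1.
  by apply: (z J2); rewrite -?(pP c).2 ?pc // R2.
have le12 := subset_leq_card J12; have leC := cardsC J2; have leC1 := cardsC J1.
rewrite card_ord in leC leC1.
have r12 := mxrankS (column_spanS aM J12); rewrite -!/(col_rank _ _) in r12.
have rm : (col_rank M J2 <= m)%N by apply: rank_leq_row.
rewrite /tight in t1 t2.
have [rn rm'] : (r <= n)%N /\ (r <= m)%N.
  by rewrite -(rM (@base_val F k)) rank_leq_col rank_leq_row.
have hW : (col_rank M J1 < #|J1|)%N \/ (col_rank M J1 = 0%N /\ #|J1| = 0%N).
  have [rE|rE] := eqVneq r n; last by left; lia.
  by right; move: leC1 t1; rewrite (hJ1 rE) cards0; lia.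
have hT : (#|~: J2| < m - col_rank M J2)%N \/
    ((m - col_rank M J2)%N = 0%N /\ #|~: J2| = 0%N).
  have [rE|rE] := eqVneq r m; last by left; lia.
  by right; move: t2; rewrite (hJ2 rE) setCT cards0; lia.
have Em : (col_rank M J1 + (#|J2| - #|J1| + (m - col_rank M J2)) = m)%N by lia.
have En : (#|J1| + (#|J2| - #|J1| + #|~: J2|) = n)%N by lia.
have rE : (col_rank M J1 + (#|J2| - #|J1| + #|~: J2|))%N = r by lia.
(* Tightness of both sets is what makes the middle block square. *)
have rE2 : (col_rank M J2 = col_rank M J1 + (#|J2| - #|J1|))%N by lia.
have cE2 : (#|J2| = #|J1| + (#|J2| - #|J1|))%N by lia.
exists (col_rank M J1), (#|J2| - #|J1|)%N, (m - col_rank M J2)%N, #|J1|, #|~: J2|.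
suff [W [S [T D]]] : exists W S T, @has_decomp F k m n N (col_rank M J1)
    (#|J2| - #|J1|) (m - col_rank M J2) #|J1| #|~: J2| W S T.
  exists W, S, T; split; last by lia.
  exact: has_decomp_equiv uR (perm_mx_is_perm _ _) D.
rewrite cE2 rE2 in N0.
(* The sizes become variables, so that eliminating [Em] and [En] gives [N] a block-shaped type. *)
move: (col_rank M J1) (m - col_rank M J2)%N #|J1| #|~: J2| (#|J2| - #|J1|)%N
  Em En rE hW hT N0 => m1 m3 n1 n3 m2 Em En rE hW hT N0.
move: N aN rN N0 ns; clear -us hW hT rE Em En.
case: _ / Em; case: _ / En => N aN rN N0 ns.
rewrite -rE in rN; rewrite (stair_mx_of_zeros N0) in aN rN *.
exact: constant_rank_stair_decomp us ns aN rN hW hT.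
Qed.

End Decompositions.

(** * Uniqueness *)

Section Uniqueness.
Variables (F : fieldType) (k : nat).
Local Notation P := {mpoly F[k]}.

Lemma completion_nat m n (M : 'M[P]_(m, n)) v i j (b : bool) :
  M i j = b%:R -> completion M v i j = b%:R.
Proof. by move=> Mb; rewrite mxE Mb rmorph_nat. Qed.

Lemma W_block_row_free p q (W : 'M[P]_(p, q)) v :
  W_block W -> row_free (completion W v).
Proof.
move=> [pq W1]; have le : (p <= q)%N by lia.
rewrite -row_leq_rank (leq_trans _ (mxrank_colsub_le (widen_ord le) _)) //.
rewrite mxrank_unit // upper_unitriangular_unit // => i j ji.
by rewrite mxE (completion_nat _ (W1 _ _ _)).
Qed.

Lemma unitri_row_free p (S : 'M[P]_p) v : unitri S -> row_free (completion S v).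
Proof.
move=> S1; rewrite row_free_unit upper_unitriangular_unit // => i j ji.
by rewrite (completion_nat _ (S1 _ _ _)).
Qed.

Lemma T_block_rank p q (T : 'M[P]_(p, q)) v :
  T_block T -> \rank (completion T v) = q.
Proof.
move=> [pq T1]; have lt (j : 'I_q) : (p - q + j < p)%N by have := ltn_ord j; lia.
apply/eqP; rewrite eqn_leq rank_leq_col.
rewrite (leq_trans _ (mxrank_rowsub_le (fun j => Ordinal (lt j)) _)) //.
rewrite mxrank_unit // upper_unitriangular_unit // => i j ji.
by rewrite mxE (completion_nat _ (T1 _ _ _)) /= ?leq_add2l ?eqn_add2l.
Qed.

Lemma stair_form_rank m n (N : 'M[P]_(m, n)) m1 m2 m3 n1 n3
    (W : 'M[P]_(m1, n1)) (S : 'M[P]_m2) (T : 'M[P]_(m3, n3)) v :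
  stair_form N W S T -> \rank (completion N v) = (m1 + (m2 + n3))%N.
Proof.
move=> [hW [hS [hT [Em [En [X [Y [Z NE]]]]]]]].
move: N NE; case: _ / Em; case: _ / En => N; rewrite castmx_id => ->.
rewrite !completion_block !completion0 mxrank_ublock_row_free;
  last exact: W_block_row_free.
rewrite mxrank_ublock_row_free; last exact: unitri_row_free.
by rewrite T_block_rank.
Qed.

Lemma card_perm_lt n (p : {perm 'I_n}) a :
  (a <= n)%N -> #|[set c | (p c < a)%N]| = a.
Proof.
move=> an; rewrite -(card_imset _ (@perm_inj _ p)).
have -> : p @: [set c | (p c < a)%N] = [set i : 'I_n | (i < a)%N].
  apply/setP => i; rewrite inE; apply/imsetP/idP => [[c]|ia].
    by rewrite inE => ? ->.
  by exists ((p^-1)%g i); rewrite ?inE ?permKV.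
by rewrite -sum1_card (eq_bigl (fun i : 'I_n => (i < a)%N)) => [|i];
  rewrite ?inE // (big_ord_narrow an) sum1_card card_ord.
Qed.

(** The columns sent to the first [n1] positions span at most [m1] dimensions, so their bound does
    not exceed the rank. The same holds for the first [n1 + m2] positions. *)
Lemma stair_form_tight m n (M : 'M[P]_(m, n)) (R : 'M[F]_m) (p : {perm 'I_n})
    m1 m2 m3 n1 n3 (W : 'M[P]_(m1, n1)) (S : 'M[P]_m2) (T : 'M[P]_(m3, n3)) :
  column_affine M -> R \in unitmx ->
  stair_form (cst_mx k R *m M *m cst_mx k (perm_mx p)) W S T ->
  [/\ forall v, \rank (completion M v) = (m1 + (m2 + n3))%N,
      tight M (m1 + (m2 + n3)) [set c | (p c < n1)%N] &
      tight M (m1 + (m2 + n3)) [set c | (p c < n1 + m2)%N]].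
Proof.
move=> aM uR st.
have rM v : \rank (completion M v) = (m1 + (m2 + n3))%N.
  by rewrite -(stair_form_rank v st) mxrank_completion_equiv ?perm_mx_is_perm.
case: st => [hW [hS [hT [Em [En [X [Y [Z NE]]]]]]]].
move: M aM R uR p NE rM; case: _ / Em; case: _ / En => M aM R uR p NE rM.
rewrite castmx_id in NE.
have z v (i : 'I_(m1 + (m2 + m3))) c :
    ((p c < n1) && (m1 <= i) || (p c < n1 + m2) && (m1 + m2 <= i))%N ->
    (R *m completion M v) i c = 0.
  move=> /(stair_mx_zeros W X Y S Z T); rewrite /stair_mx -NE.
  move/(congr1 (meval v)); rewrite meval0; apply: etrans.
  transitivity (completion (cst_mx k R *m M *m cst_mx k (perm_mx p)) v i (p c)).
    by rewrite completionM_r completionM_l mulmx_perm_entry permK.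
  by rewrite mxE.
have cC (J : {set 'I_(n1 + (m2 + n3))}) := cardsC J.
split=> //; apply: (tight_le aM rM).
  have le : (col_rank M [set c | (p c < n1)%N] <= m1)%N.
    by apply: (col_rank_le uR) => v i c; rewrite inE => h1 h2; rewrite z ?h1 ?h2.
  have := cC [set c | (p c < n1)%N]; rewrite card_ord card_perm_lt ?leq_addr //; lia.
have le : (col_rank M [set c | (p c < n1 + m2)%N] <= m1 + m2)%N.
  by apply: (col_rank_le uR) => v i c; rewrite inE => h1 h2; rewrite z ?h1 ?h2 ?orbT.
have := cC [set c | (p c < n1 + m2)%N]; rewrite card_ord card_perm_lt; lia.
Qed.

Lemma perm_mx_block_diag (A : pzSemiRingType) a b (p : {perm 'I_(a + b)}) :
  (forall j, (p j < a)%N = (j < a)%N) ->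
  exists (p1 : {perm 'I_a}) (p2 : {perm 'I_b}),
    perm_mx p = block_mx (perm_mx p1) 0 0 (perm_mx p2) :> 'M[A]_(a + b) /\
    forall j, p (rshift a j) = rshift a (p2 j).
Proof.
move=> pa.
have /fin_all_exists[f1 f1P] (j : 'I_a) : exists j', p (lshift b j) = lshift b j'.
  have [j' e|j' e] := split_ordP (p (lshift b j)); first by exists j'.
  by have := pa (lshift b j); rewrite e /= ltn_ord ltnNge leq_addr.
have /fin_all_exists[f2 f2P] (j : 'I_b) : exists j', p (rshift a j) = rshift a j'.
  have [j' e|j' e] := split_ordP (p (rshift a j)); last by exists j'.
  by have := pa (rshift a j); rewrite e /= ltn_ord ltnNge leq_addr.
have f1I : injective f1.
  by move=> x y e; apply: (@lshift_inj a b); apply: (@perm_inj _ p); rewrite !f1P e.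
have f2I : injective f2.
  by move=> x y e; apply: (@rshift_inj a b); apply: (@perm_inj _ p); rewrite !f2P e.
exists (perm f1I), (perm f2I); split=> [|j]; last by rewrite permE.
apply/matrixP => x y; rewrite [LHS]mxE [LHS]mxE.
have [i ->|i ->] := split_ordP x; have [j ->|j ->] := split_ordP y;
  rewrite ?f1P ?f2P ?block_mxEul ?block_mxEur ?block_mxEdl ?block_mxEdr;
  rewrite ?[RHS]mxE ?[RHS]mxE ?permE ?eq_lshift ?eq_rshift ?eq_lrshift ?eq_rlshift //.
Qed.

(** The zero lower left block forces the lower left part of [A] to annihilate a completion of [W],
    which is row free. Hence [A] is block triangular with invertible diagonal blocks. The last
    conclusion allows the lemma to be applied again to the lower right block. *)
Lemma block_equiv a b c d (W W' : 'M[P]_(a, c)) X X' (D D' : 'M[P]_(b, d))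
    (A : 'M[F]_(a + b)) (p : {perm 'I_(c + d)}) :
  (forall v, row_free (completion W v)) -> A \in unitmx ->
  (forall j, (p j < c)%N = (j < c)%N) ->
  block_mx W' X' 0 D' = cst_mx k A *m block_mx W X 0 D *m cst_mx k (perm_mx p) ->
  exists (A1 : 'M[F]_a) (A2 : 'M[F]_b) (p1 : {perm 'I_c}) (p2 : {perm 'I_d}),
    [/\ A1 \in unitmx /\ A2 \in unitmx,
        W' = cst_mx k A1 *m W *m cst_mx k (perm_mx p1),
        D' = cst_mx k A2 *m D *m cst_mx k (perm_mx p2) &
        forall j, p (rshift c j) = rshift c (p2 j)].
Proof.
move=> Wfree uA pc E; have [p1 [p2 [pE pP]]] := perm_mx_block_diag F pc.
rewrite pE -(submxK A) in E; rewrite -(submxK A) in uA.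
set A1 := ulsubmx A in E uA; set A12 := ursubmx A in E uA.
set A21 := dlsubmx A in E uA; set A2 := drsubmx A in E uA.
rewrite !cst_mx_block ![cst_mx k 0]map_mx0 !mulmx_block in E.
rewrite !(mulmx0, mul0mx, addr0, add0r) in E.
case/eq_block_mx: E => WE _ A21W DE.
have A210 : A21 = 0.
  have /esym/(congr1 (fun B => completion B (@base_val F k))) := A21W.
  rewrite completionM_r completionM_l completion0 => /eqP.
  by rewrite !mulmx_free_eq0 ?row_free_unit ?unitmx_perm // => /eqP.
rewrite A210 in DE uA.
have [u1 u2] : A1 \in unitmx /\ A2 \in unitmx.
  by apply/andP; rewrite !unitmxE -unitrM -(det_ublock A1 A12) -unitmxE.
exists A1, A2, p1, p2; split=> //.
by rewrite DE [cst_mx k 0]map_mx0 mul0mx add0r.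
Qed.

Lemma stair_equiv_blocks m1 m2 m3 n1 n3
    (W W' : 'M[P]_(m1, n1)) X X' Y Y' (S S' : 'M[P]_m2) Z Z' (T T' : 'M[P]_(m3, n3))
    (A : 'M[F]_(m1 + (m2 + m3))) (p : {perm 'I_(n1 + (m2 + n3))}) :
  W_block W -> unitri S -> A \in unitmx ->
  (forall j, (p j < n1)%N = (j < n1)%N) ->
  (forall j, (p j < n1 + m2)%N = (j < n1 + m2)%N) ->
  stair_mx W' X' Y' S' Z' T' =
    cst_mx k A *m stair_mx W X Y S Z T *m cst_mx k (perm_mx p) ->
  [/\ aci_equiv W W', aci_equiv S S' & aci_equiv T T'].
Proof.
move=> hW hS uA p1 p2 E.
have [A1 [AD [q1 [qD [[uA1 uAD] WE DE qP]]]]] :=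
  block_equiv (fun v => W_block_row_free v hW) uA p1 E.
have qD2 (j : 'I_(m2 + n3)) : (qD j < m2)%N = (j < m2)%N.
  by have := p2 (rshift n1 j); rewrite qP /= !ltn_add2l.
have [A2 [A3 [q2 [q3 [[uA2 uA3] SE TE _]]]]] :=
  block_equiv (fun v => unitri_row_free v hS) uAD qD2 DE.
split; [exists A1, (perm_mx q1) | exists A2, (perm_mx q2) |
  exists A3, (perm_mx q3)]; by rewrite perm_mx_is_perm.
Qed.

(** The sets [J1 :&: J1'] and [J2 :|: J2'] are tight and give a decomposition whose middle block is
    at least as large as [S]. Maximality of [S] leaves no room, so the intersection is [J1] and the
    union is [J2]. *)
Lemma max_decomp_columns (s : seq F) m n (M : 'M[P]_(m, n)) (R R' : 'M[F]_m)
    (p p' : {perm 'I_n})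
    m1 m2 m3 n1 n3 (W : 'M[P]_(m1, n1)) (S : 'M[P]_m2) (T : 'M[P]_(m3, n3))
    m1' m2' m3' n1' n3' (W' : 'M[P]_(m1', n1')) (S' : 'M[P]_m2')
    (T' : 'M[P]_(m3', n3')) :
  uniq s -> (n <= size s)%N -> column_affine M -> R \in unitmx -> R' \in unitmx ->
  stair_form (cst_mx k R *m M *m cst_mx k (perm_mx p)) W S T ->
  stair_form (cst_mx k R' *m M *m cst_mx k (perm_mx p')) W' S' T' ->
  has_max_decomp M W S T ->
  [set c | (p c < n1)%N] \subset [set c | (p' c < n1')%N] /\
  [set c | (p' c < n1' + m2')%N] \subset [set c | (p c < n1 + m2)%N].
Proof.
move=> us ns aM uR uR' st st' [_ mx].
have [rM t1 t2] := stair_form_tight aM uR st.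
have [rM' t1' t2'] := stair_form_tight aM uR' st'.
set J1 := [set c | _] in t1 *; set J2 := [set c | _] in t2 *.
set J1' := [set c | (_ < n1')%N] in t1' *; set J2' := [set c | _] in t2' *.
set r := (m1 + (m2 + n3))%N in rM t1 t2.
have rE : (m1' + (m2' + n3'))%N = r by rewrite -(rM (@base_val F k)) rM'.
rewrite rE in t1' t2'.
have [_ tI] := tightUI aM rM t1 t1'; have [tU _] := tightUI aM rM t2 t2'.
have [[hW _] [_ [[hT _] [Em [En _]]]]] := st.
have c1 : #|J1| = n1 by rewrite card_perm_lt //; lia.
have c2 : #|J2| = (n1 + m2)%N by rewrite card_perm_lt //; lia.
have J12 : J1 \subset J2 by apply/subsetP => c; rewrite !inE => h; apply: ltn_addr.
have IU : J1 :&: J1' \subset J2 :|: J2'.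
  exact: subset_trans (subsetIl _ _) (subset_trans J12 (subsetUl _ _)).
have [||a [b [c [d [e [W0 [S0 [T0 [D sz]]]]]]]]] := tight_decomp us ns aM rM tI tU IU.
(* If [r = n] then [m1 = n1], so [W] is not wide and must be void. *)
- move=> rn; have -> : J1 = set0 by apply/eqP; rewrite -cards_eq0 c1; lia.
  exact: set0I.
- move=> rm; have -> : J2 = setT.
    apply/eqP; rewrite -subTset; apply/subsetP => c _; rewrite inE.
    by have := ltn_ord (p c); lia.
  exact: setTU.
have le := mx _ _ _ _ _ _ _ _ D.
have leI := subset_leq_card (subsetIl J1 J1').
have leU := subset_leq_card (subsetUl J2 J2').
have cI : #|J1 :&: J1'| = #|J1| by lia.
have cU : #|J2 :|: J2'| = #|J2| by lia.
split.
  by apply/setIidPl/eqP; rewrite eqEcard subsetIl cI leqnn.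
have /eqP -> : J2 == J2 :|: J2' by rewrite eqEcard subsetUl cU leqnn.
exact: subsetUr.
Qed.

End Uniqueness.

(** * Existence of the block form and uniqueness of its diagonal blocks *)

Theorem theorem7p2 (F : fieldType) (k m n : nat)
  (hF : exists s : seq F, uniq s /\ size s = maxn m n.+1)
  (M : 'M[{mpoly F[k]}]_(m, n)) (hM : is_ACI M) :
  (constantRank M <->
     exists (m1 m2 m3 n1 n3 : nat) (W : 'M[{mpoly F[k]}]_(m1, n1))
            (S : 'M[{mpoly F[k]}]_m2) (T : 'M[{mpoly F[k]}]_(m3, n3)),
       has_decomp M W S T) /\
  (forall (m1 m2 m3 n1 n3 : nat) (W : 'M[{mpoly F[k]}]_(m1, n1))
          (S : 'M[{mpoly F[k]}]_m2) (T : 'M[{mpoly F[k]}]_(m3, n3))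
          (m1' m2' m3' n1' n3' : nat) (W' : 'M[{mpoly F[k]}]_(m1', n1'))
          (S' : 'M[{mpoly F[k]}]_m2') (T' : 'M[{mpoly F[k]}]_(m3', n3')),
     has_max_decomp M W S T -> has_max_decomp M W' S' T' ->
     [/\ aci_equivT W W', aci_equivT S S' & aci_equivT T T']).
Proof.
have aM := is_ACI_column_affine hM.
have [s [us ss]] := hF; have ns : (n <= size s)%N by rewrite ss; lia.
split; first split.
- move=> [r [[_ ubr] [_ lbr]]].
  have rM v : \rank (completion M v) = r by apply/eqP; rewrite eqn_leq ubr lbr.
  have [J tJ] := exists_tight aM rM.
  have [rn rm] : (r <= n)%N /\ (r <= m)%N.
    by rewrite -(rM (@base_val F k)) rank_leq_col rank_leq_row.
  (* One tight set serves as both ends of the chain, with a void middle block, unless the rank is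
     full. The empty set is tight when [r = n], and the set of all columns when [r = m]; they
     replace the corresponding end. *)
  pose J1 := if r == n then set0 else J; pose J2 := if r == m then setT else J.
  have t1 : tight M r J1.
    rewrite /J1; case: eqP => // rE; apply: (tight_le aM rM).
    rewrite setC0 cardsT card_ord rE -[leqRHS]add0n leq_add2r leqn0.
    rewrite mxrank_eq0 -submx0; apply: point_span_subP => j o.
    by rewrite inE.
  have t2 : tight M r J2.
    rewrite /J2; case: eqP => // rE; apply: (tight_le aM rM).
    by rewrite setCT cards0 addn0 rE rank_leq_row.
  have [|||a [b [c [d [e [W [S [T [D _]]]]]]]]] := tight_decomp us ns aM rM t1 t2.
  + rewrite /J1 /J2; case: eqP => _; first exact: sub0set.
    by case: eqP; rewrite ?subsetT.
  + by move=> rE; rewrite /J1 rE eqxx.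
  + by move=> rE; rewrite /J2 rE eqxx.
  by exists a, b, c, d, e, W, S, T.
- move=> [m1 [m2 [m3 [n1 [n3 [W [S [T [R [Q [uR [pQ st]]]]]]]]]]]].
  have rM v : \rank (completion M v) = (m1 + (m2 + n3))%N.
    by rewrite -(stair_form_rank v st) mxrank_completion_equiv.
  exists (m1 + (m2 + n3))%N.
  by split; split=> [|v]; rewrite ?rM //; exists (@base_val F k).
move=> m1 m2 m3 n1 n3 W S T m1' m2' m3' n1' n3' W' S' T' mD mD'.
have [[R [Q [uR [/is_perm_mxP[p ->] st]]]] _] := mD.
have [[R' [Q' [uR' [/is_perm_mxP[p' ->] st']]]] _] := mD'.
have [s1 s2] := max_decomp_columns us ns aM uR uR' st st' mD.
have [s1' s2'] := max_decomp_columns us ns aM uR' uR st' st mD'.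
have J1E : [set c | (p c < n1)%N] = [set c | (p' c < n1')%N].
  by apply/eqP; rewrite eqEsubset s1.
have J2E : [set c | (p c < n1 + m2)%N] =
    [set c | (p' c < n1' + m2')%N].
  by apply/eqP; rewrite eqEsubset s2'.
have [rM _ _] := stair_form_tight aM uR st.
have [rM' _ _] := stair_form_tight aM uR' st'.
have rE : (m1' + (m2' + n3') = m1 + (m2 + n3))%N by rewrite -(rM (@base_val F k)) rM'.
case: st => hW [hS [hT [Em [En [X [Y [Z NE]]]]]]].
case: st' => _ [_ [_ [Em' [En' [X' [Y' [Z' NE']]]]]]].
(* The common column sets determine [n1] and [m2] by counting; then [n3] follows from [n], [m1] from
   the rank and [m3] from [m]. *)
have e1 : n1' = n1.
  by rewrite -(@card_perm_lt n p n1) ?J1E ?card_perm_lt //; lia.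
have e2 : m2' = m2.
  have : (n1' + m2' = n1 + m2)%N.
    by rewrite -(@card_perm_lt n p (n1 + m2)) ?J2E ?card_perm_lt //; lia.
  lia.
have e3 : n3' = n3 by lia.
have e4 : m1' = m1 by lia.
have e5 : m3' = m3 by lia.
clear mD mD' s1 s2 s1' s2' rM rM' rE.
subst n1' m2' n3' m1' m3'; subst m n.
rewrite !castmx_id in NE NE'.
(* Going back from the first form to [M] and on to the second one is an equivalence whose
   permutation preserves both column ranges. *)
have E : stair_mx W' X' Y' S' Z' T' = cst_mx k (R' *m invmx R) *m
    stair_mx W X Y S Z T *m cst_mx k (perm_mx (p^-1 * p')%g).
  rewrite /stair_mx -NE -NE' perm_mxM !cst_mxM !mulmxA; congr (_ *m _).
  rewrite -[_ *m cst_mx k R]mulmxA -cst_mxM mulVmx // cst_mx1 mulmx1.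
  by rewrite -mulmxA -cst_mxM -perm_mxM mulgV perm_mx1 cst_mx1 mulmx1.
have [|||eW eS eT] := stair_equiv_blocks hW hS _ _ _ E.
- by rewrite unitmx_mul uR' unitmx_inv.
- by move=> j; have /setP/(_ ((p^-1)%g j)) := J1E; rewrite !inE permM permKV => ->.
- by move=> j; have /setP/(_ ((p^-1)%g j)) := J2E; rewrite !inE permM permKV => ->.
by split; exists erefl, erefl; rewrite castmx_id.
Qed.
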